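(* Consider either the Top-$k$ problem ($1\le k<K$) or the thresholding bandit problem with threshold $\tau$. Let $\delta\in(0,1)$ and $0<T_{\min}<T_{\max}$. Consider a batched algorithm that is $\delta$-correct on Gaussian instances with variance $\sigma^2$ of complexity $T^\star\in(T_{\min},T_{\max})$. Then for any such Gaussian instance with mean vector $\mu$ and complexity $T^\star(\mu)\in(T_{\min},T_{\max})$, $$\mathbb{E}_{\mu}[R_\delta]\ \ge\ \min\left\{\frac{\ln\frac{T^\star(\mu)}{T_{\min}}}{2\ln\left(\left(\ln\frac{T^\star(\mu)}{T_{\min}}\right)^2\max\{e,C_\delta\}\right)},\ \frac16\ln\frac{T^\star(\mu)}{T_{\min}},\ \frac{1}{6\delta}\right\},$$ where $$C_\delta=1+4\gamma\ln\left(\frac1\delta\right)\ln\frac{T^\star(\mu)}{T_{\min}}\left(1+\sqrt{\frac{T^\star(\mu)\Delta^2}{\sigma^2}}\right)^2,\qquad \gamma=\sup_{\mu':\,T^\star(\mu')\in(T_{\min},T_{\max})}\frac{\mathbb{E}_{\mu'}[\tau_\delta]}{\ln(1/\delta)\,T^\star(\mu')},$$ the supremum being over Gaussian instances with variance $\sigma^2$, and where $\Delta=\frac{\max_i\mu_i-\min_i\mu_i}{2}$ in the Top-$k$ problem and $\Delta=\max_i|\mu_i-\tau|$ in the thresholding bandit problem.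
   Context: Fix $K$ arms and $\sigma>0$. $\Sigma_K$ is the probability simplex of $\mathbb{R}^K$. Bandit instances here have Gaussian arms with variance $\sigma^2$ and are identified with their mean vector $\mu\in\mathbb{R}^K$; $\mathbb{P}_\mu,\mathbb{E}_\mu$ refer to the interaction with that instance. Top-$k$ problem: answers are the subsets of $\{1,\dots,K\}$ of size $k$; for $\mu$ whose $k$-th largest entry is strictly larger than its $(k+1)$-th largest entry, the correct answer $i^\star(\mu)$ is the set of the $k$ arms with largest means (best arm identification is $k=1$). Thresholding bandit problem with threshold $\tau\in\mathbb{R}$: answers are all subsets of $\{1,\dots,K\}$; for $\mu$ with $\mu_i\ne\tau$ for all $i$, $i^\star(\mu)=\{i:\mu_i>\tau\}$. $Alt_\mu$ is the set of mean vectors $\lambda$ (with a well-defined correct answer) such that $i^\star(\lambda)\neq i^\star(\mu)$, and $$T^\star(\mu)^{-1}=\sup_{w\in\Sigma_K}\inf_{\lambda\in Alt_\mu}\sum_{i=1}^K w_i\frac{(\mu_i-\lambda_i)^2}{2\sigma^2}$$ ($T^\star(\mu)$ is the complexity of the instance). A batched algorithm proceeds in batches: at the start of a batch, based on all past observations, it chooses how many times to sample each arm in that batch, then observes all those samples; after each batch it either stops and returns an answer or starts a new batch. Nothing can be changed or stopped during a batch. $\tau_\delta$ is the total number of samples used when stopping and $R_\delta$ the number of batches used. An algorithm is $\delta$-correct on a class of instances if on each of them the probability of returning an incorrect answer is at most $\delta$. *)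

(* Defs.v *)
From HB Require Import structures.
From mathcomp Require Import all_boot all_order all_algebra.
From mathcomp Require Import all_classical all_reals all_analysis.

Set Implicit Arguments.
Unset Strict Implicit.
Unset Printing Implicit Defensive.

Import Order.TTheory GRing.Theory Num.Theory.
Import numFieldNormedType.Exports.

Local Open Scope classical_set_scope.
Local Open Scope ring_scope.

(* A Gaussian instance with K arms is identified with its mean vector
   mu : 'I_K -> R. *)

Inductive problem (R : realType) :=
  | TopK of nat
  | Thresholding of R.
Arguments TopK {R}.

Section identification_problem.
Variables (R : realType) (K : nat).
Implicit Types (pb : problem R) (mu lambda w : 'I_K -> R).

Definition valid_problem pb : Prop :=
  match pb with
  | TopK k => (1 <= k)%N /\ (k < K)%N
  | Thresholding _ => True
  end.

Definition answers pb : {set {set 'I_K}} :=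
  match pb with
  | TopK k => [set A : {set 'I_K} | #|A| == k]%SET
  | Thresholding _ => [set: {set 'I_K}]%SET
  end.

(* kth_largest mu 1 is the largest entry, counting multiplicities; the value
   is only meaningful for 1 <= k <= K. *)
Definition kth_largest mu (k : nat) : R :=
  nth 0 (sort (fun x y : R => y <= x) (codom mu)) k.-1.

Definition well_defined pb mu : Prop :=
  match pb with
  | TopK k => kth_largest mu k.+1 < kth_largest mu k
  | Thresholding tau => forall i, mu i != tau
  end.

Definition correct_answer pb mu : {set 'I_K} :=
  match pb with
  | TopK k => [set i | kth_largest mu k <= mu i]%SET
  | Thresholding tau => [set i | tau < mu i]%SET
  end.

Definition Alt pb mu : set ('I_K -> R) :=
  [set lambda | well_defined pb lambda /\
                correct_answer pb lambda != correct_answer pb mu].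

Definition simplex : set ('I_K -> R) :=
  [set w | (forall i, 0 <= w i) /\ \sum_i w i = 1].

Definition inv_complexity pb (sigma : R) mu : \bar R :=
  ereal_sup [set ereal_inf
    [set (\sum_i w i * ((mu i - lambda i) ^+ 2 / (2 * sigma ^+ 2)))%:E
      | lambda in Alt pb mu] | w in simplex].

(* In \bar R, 0^-1 = +oo and +oo^-1 = 0. *)
Definition complexity pb (sigma : R) mu : \bar R :=
  ((inv_complexity pb sigma mu)^-1)%E.

Definition instances pb (sigma Tmin Tmax : R) : set ('I_K -> R) :=
  [set mu | well_defined pb mu /\
            (Tmin%:E < complexity pb sigma mu < Tmax%:E)%E].

Definition Delta pb mu : R :=
  match pb with
  | TopK _ => (sup (range mu) - inf (range mu)) / 2
  | Thresholding tau => \big[Num.max/0]_i `|mu i - tau|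
  end.

End identification_problem.

(* A history lists the past batches; a batch gives, for each arm, the samples
   of that arm observed during the batch, so that the number of times the arm
   was sampled is the size of that list. *)
Definition history (R : realType) (K : nat) := seq {ffun 'I_K -> seq R}.

HB.instance Definition _ (R : realType) (K : nat) := Choice.on (history R K).
HB.instance Definition _ (R : realType) (K : nat) :=
  isPointed.Build (history R K) [::].

Section history.
Variables (R : realType) (K : nat).

Definition batch_sizes (h : history R K) : seq {ffun 'I_K -> nat} :=
  [seq [ffun i => size (b i)] | b : {ffun 'I_K -> seq R} <- h].

Definition sample (h : history R K) (b : nat) (i : 'I_K) (m : nat) : R :=
  nth 0 (nth [ffun=> [::]] h b i) m.

Definition pulls (h : history R K) (i : 'I_K) : nat :=
  (\sum_(b <- h) size (b i))%N.

Definition total_pulls (h : history R K) : nat := (\sum_i pulls h i)%N.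

(* Histories are the countable disjoint union, over the possible sequences of
   batch sizes s, of finite-dimensional real spaces; these sets generate the
   disjoint union of the Borel sigma-algebras. *)
Definition history_cylinders : set (set (history R K)) :=
  [set [set h | batch_sizes h = s] | s in [set: seq {ffun 'I_K -> nat}]] `|`
  [set A | exists b i m (B : set R),
      measurable B /\ A = [set h | B (sample h b i m)]].

Definition mhistory := g_sigma_algebraType history_cylinders.

End history.

(* batch_size chooses the numbers of samples of the next batch (of the first
   one, on the empty history) and decision is consulted after each batch: None
   starts a new batch, Some A stops and returns A. Both may use an internal
   random seed, drawn before the interaction; a deterministic algorithm ignores
   it. *)
Record batched_algorithm (R : realType) (K : nat) (ans : {set {set 'I_K}})
    (d : measure_display) (S : measurableType d) := BatchedAlgorithm {
  seed_law : probability S R ;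
  batch_size : S -> mhistory R K -> {ffun 'I_K -> nat} ;
  decision : S -> mhistory R K -> option {set 'I_K} ;
  decision_in : forall s h A, decision s h = Some A -> A \in ans ;
  measurable_batch_size : forall n,
    measurable [set sh : S * mhistory R K | batch_size sh.1 sh.2 = n] ;
  measurable_decision : forall a,
    measurable [set sh : S * mhistory R K | decision sh.1 sh.2 = a] }.

(* The probability space of the interaction, under P mu: X i n is the reward of
   the (n+1)-th sample of arm i. normal_prob takes the standard deviation. *)
Record gaussian_bandit (R : realType) (K : nat) (sigma : R)
    (d : measure_display) (S : measurableType d) (nu : probability S R)
    (d' : measure_display) (Omega : measurableType d')
    (P : ('I_K -> R) -> probability Omega R)
    (U : Omega -> S) (X : 'I_K -> nat -> Omega -> R) : Prop := GaussianBandit {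
  measurable_seed : measurable_fun setT U ;
  measurable_reward : forall i n, measurable_fun setT (X i n) ;
  law_of_seed : forall mu (A : set S), measurable A ->
    P mu (U @^-1` A) = nu A ;
  law_of_reward : forall mu i n (B : set R), measurable B ->
    P mu (X i n @^-1` B) = normal_prob (mu i) sigma B ;
  mutual_independence : forall mu (A : set S) (B : 'I_K -> nat -> set R) N,
    measurable A -> (forall i n, measurable (B i n)) ->
    (P mu (U @^-1` A `&`
           [set omega | forall i n, (n < N)%N -> B i n (X i n omega)]) =
     P mu (U @^-1` A) *
     \big[mule/1]_(i < K) \big[mule/1]_(n < N) P mu (X i n @^-1` B i n))%E }.

Section interaction.
Variables (R : realType) (K : nat) (ans : {set {set 'I_K}}).
Variables (d : measure_display) (S : measurableType d).
Variable alg : batched_algorithm R ans S.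
Variables (Omega : Type) (U : Omega -> S) (X : 'I_K -> nat -> Omega -> R).

(* The history after r batches, if the algorithm were never to stop. *)
Fixpoint run (omega : Omega) (r : nat) : history R K :=
  if r is r'.+1 then
    let h := run omega r' in
    rcons h [ffun i => [seq X i m omega
                       | m <- iota (pulls h i) (batch_size alg (U omega) h i)]]
  else [::].

Definition stops (omega : Omega) (r : nat) : bool :=
  (0 < r)%N && isSome (decision alg (U omega) (run omega r)).

Definition stopping_batch (omega : Omega) : option nat :=
  if pselect (exists r, stops omega r) is left ex then Some (ex_minn ex)
  else None.

Definition nb_batches (omega : Omega) : \bar R :=
  if stopping_batch omega is Some r then r%:R%:E else +oo%E.

Definition nb_samples (omega : Omega) : \bar R :=
  if stopping_batch omega is Some r then (total_pulls (run omega r))%:R%:E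
  else +oo%E.

Definition returned_answer (omega : Omega) : option {set 'I_K} :=
  if stopping_batch omega is Some r then decision alg (U omega) (run omega r)
  else None.

End interaction.

Section guarantees.
Variables (R : realType) (K : nat) (pb : problem R).
Variables (d : measure_display) (S : measurableType d).
Variable alg : batched_algorithm R (answers K pb) S.
Variables (d' : measure_display) (Omega : measurableType d').
Variables (P : ('I_K -> R) -> probability Omega R).
Variables (U : Omega -> S) (X : 'I_K -> nat -> Omega -> R).

Definition delta_correct (delta : R) (C : set ('I_K -> R)) : Prop :=
  forall mu, C mu ->
    (P mu [set omega | exists2 A, returned_answer alg U X omega = Some A &
                                  A != correct_answer pb mu] <= delta%:E)%E.

Definition expected_batches (mu : 'I_K -> R) : \bar R :=
  (\int[P mu]_omega nb_batches alg U X omega)%E.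

Definition expected_samples (mu : 'I_K -> R) : \bar R :=
  (\int[P mu]_omega nb_samples alg U X omega)%E.

Definition gamma (sigma delta Tmin Tmax : R) : \bar R :=
  ereal_sup [set (expected_samples mu /
                  ((ln (1 / delta))%:E * complexity pb sigma mu))%E
            | mu in instances pb sigma Tmin Tmax].

(* T^*(mu) as a real number: it is finite on the instances considered. *)
Definition Tstar (sigma : R) (mu : 'I_K -> R) : R :=
  fine (complexity pb sigma mu).

(* Possibly +oo, when gamma is. *)
Definition C_delta (sigma delta Tmin Tmax : R) (mu : 'I_K -> R) : \bar R :=
  (1 + 4%:E * gamma sigma delta Tmin Tmax *
       (ln (1 / delta) * ln (Tstar sigma mu / Tmin) *
        (1 + Num.sqrt (Tstar sigma mu * Delta pb mu ^+ 2 / sigma ^+ 2)) ^+ 2)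
       %:E)%E.

End guarantees.

(* Main.v *)
Require Import Defs.
From HB Require Import structures.
From mathcomp Require Import all_boot all_order all_algebra fingroup perm ring lra.
From mathcomp Require Import all_classical all_reals all_analysis.
From mathcomp Require Import measurable_realfun.
Import Order.TTheory GRing.Theory Num.Theory.
Import numFieldNormedType.Exports.
Local Open Scope classical_set_scope.
Local Open Scope ring_scope.

(* For a scale s >= 1 dilate the instance mu by the factor s around a center c
   (the midrange of mu for Top-k, the threshold tau otherwise): the complexity
   is divided by s^2, and the new instance is within s Delta of mu in sup norm.
   With rho = L^2 max{e, C_delta} and k the largest integer smaller than
   L / ln rho, let nu_0, ..., nu_(k-1) be such dilations, of complexities
   T_j = T^*(mu) / rho^(k - j), all in (Tmin, Tmax).

   On nu_j the expected number of samples is at most c_j = gamma ln(1/delta) T_j,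
   so by Markov's inequality nu_j uses more than L c_j samples with probability
   at most 1/L. As long as at most L c_(j-1) samples have been taken, nu_j and mu
   can hardly be distinguished, because
   L c_(j-1) (s_j Delta)^2 / sigma^2 <= 1 / (4 L^2); and the size of the next
   batch depends on these samples only. Hence on mu, too, the total number of
   samples after batch j + 1 exceeds L c_j only with probability O(1/L), and after
   k batches it is at most L c_(k-1), except on an event of small probability.
   That many samples do not distinguish mu from an instance mu' of the same
   complexity with another correct answer (two arms exchanged, or the means
   reflected through tau), so stopping then has probability at most
   2 delta + O(1/L).

   Indistinguishability is quantified by the chi-square divergence: if Z is the
   likelihood ratio of lambda to mu on at most M samples, then Z^2 is at most
   exp(M D^2 / sigma^2) times the likelihood ratio of 2 lambda - mu to mu, where
   D = sup_i |lambda_i - mu_i|. *)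

(** * Likelihood ratios of Gaussian samples *)

Section density.
Local Open Scope ereal_scope.
Import HBNNSimple.

(** For a simple function [g] the claim is the hypothesis applied to its level sets; monotone
    convergence, applied to both integrals, gives the general case. The density is given by its
    values on sets, so that it fits weighted measures and image laws alike. *)
Lemma ge0_integral_density {d} {T : measurableType d} {R : realType}
    (m1 m2 : {measure set T -> \bar R}) (f : T -> R) :
  measurable_fun [set: T] f -> (forall x, (0 <= f x)%R) ->
  (forall A, measurable A -> m2 A = \int[m1]_(x in A) (f x)%:E) ->
  forall g : T -> \bar R, measurable_fun [set: T] g -> (forall x, 0 <= g x) ->
  \int[m2]_x g x = \int[m1]_x (g x * (f x)%:E).
Proof.
move=> mf f0 m2E g mg g0.
have mfE : measurable_fun [set: T] (EFin \o f) by exact/measurable_EFinP.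
pose h := nnsfun_approx measurableT mg.
have hg x : (EFin \o h n) x @[n --> \oo] --> g x.
  by apply: cvg_nnsfun_approx => //.
have ndh x : {homo (fun n => (h n x)%:E) : a b / (a <= b)%N >-> a <= b}.
  by move=> a b ab; rewrite lee_fin; exact/lefP/nd_nnsfun_approx.
have mh n : measurable_fun [set: T] (EFin \o h n).
  exact/measurable_EFinP/measurable_funP.
transitivity (limn (fun n => \int[m2]_x (EFin \o h n) x)).
  rewrite -monotone_convergence//.
  - by apply: eq_integral => x _; exact/esym/cvg_lim.
  - by move=> n x _; rewrite lee_fin.
  - by move=> x _; exact: ndh.
transitivity (limn (fun n => \int[m1]_x ((EFin \o h n) x * (f x)%:E))); last first.
  rewrite -monotone_convergence//.
  - apply: eq_integral => x _; apply/cvg_lim => //.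
    by apply: cvgeZr => //; exact: hg.
  - by move=> n; apply: emeasurable_funM.
  - by move=> n x _; rewrite mule_ge0// lee_fin.
  - by move=> x _ a b ab; apply: lee_wpmul2r; [rewrite lee_fin|exact: ndh].
congr (limn _); apply/funext => n.
transitivity (\int[m2]_x (\sum_(y \in range (h n)) (y * \1_(h n @^-1` [set y]) x)%:E)).
  by apply: eq_integral => t tE; rewrite /= fimfunE -fsumEFin.
have indich r : measurable_fun [set: T] (fun x => (r * \1_(h n @^-1` [set r]) x)%:E).
  by apply: (measurable_comp measurableT) => //; exact: measurable_funM.
rewrite ge0_integral_fsum//; last by move=> y x _; exact: nnfun_muleindic_ge0.
transitivity (\int[m1]_x (\sum_(y \in range (h n))
    (y * \1_(h n @^-1` [set y]) x)%:E * (f x)%:E)).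
  rewrite ge0_integral_fsum//; last 2 first.
  - by move=> y; apply: emeasurable_funM.
  - by move=> y x _; apply: mule_ge0; [exact: nnfun_muleindic_ge0|rewrite lee_fin].
  apply: eq_fsbigr => r rhn.
  under [RHS]eq_integral do rewrite EFinM -muleA.
  under eq_integral do rewrite EFinM.
  rewrite integralZl_indic_nnsfun// [RHS]ge0_integralZl//; last 3 first.
  - by apply: emeasurable_funM => //; exact/measurable_EFinP.
  - by move=> t _; rewrite mule_ge0 ?lee_fin ?f0.
  - by move: rhn; rewrite inE => -[t _ <-]; rewrite lee_fin.
  rewrite integral_indic// setIT m2E//; congr (_ * _).
  rewrite [LHS]integral_mkcond; apply: eq_integral => x _.
  by rewrite epatch_indic /= muleC.
apply: eq_integral => x _.
rewrite /= fimfunE -fsumEFin// ge0_mule_fsuml// => y.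
exact: nnfun_muleindic_ge0.
Qed.
End density.

Section gauss.
Variables (R : realType) (sigma : R).
Hypothesis sigma0 : 0 < sigma.

(** The density of N(b, sigma^2) over that of N(a, sigma^2), with (x - a)^2 - (x - b)^2 expanded in
    the exponent. *)
Definition gauss_lr (a b x : R) : R :=
  expR ((2 * (b - a) * x - (b ^+ 2 - a ^+ 2)) / (2 * sigma ^+ 2)).

Lemma normal_pdf_lr a b x :
  gauss_lr a b x * normal_pdf a sigma x = normal_pdf b sigma x.
Proof.
have s0 : sigma != 0 by rewrite gt_eqF.
rewrite !normal_pdfE// mulrCA /normal_fun -expRD; congr (_ * expR _).
by field.
Qed.

(** Doubling an exponent that is affine in [x] doubles its slope, which is the slope for the mean
    [2 * b - a]; the constants differ by (b - a)^2 / sigma^2. *)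
Lemma gauss_lr_sqr a b x :
  gauss_lr a b x ^+ 2 =
  expR ((b - a) ^+ 2 / sigma ^+ 2) * gauss_lr a (2 * b - a) x.
Proof.
have s0 : sigma != 0 by rewrite gt_eqF.
by rewrite -expRM_natl -expRD; congr expR; field.
Qed.

Lemma measurable_gauss_lr a b : measurable_fun setT (gauss_lr a b).
Proof.
apply: measurableT_comp => //; apply: measurable_funM => //.
by apply: measurable_funB => //; apply: measurable_funM.
Qed.
End gauss.

Section density_measure.
Local Open Scope ereal_scope.
Context {d} {T : measurableType d} {R : realType}.
Variables (m : {measure set T -> \bar R}) (f : T -> R).

(** The proofs [mf] and [f0] are arguments so that the measure structure declared below can be
    inferred from the term itself. *)
Definition density_measure (mf : measurable_fun [set: T] f)
  (f0 : forall x, (0 <= f x)%R) (A : set T) := \int[m]_(x in A) (f x)%:E.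

Hypothesis mf : measurable_fun [set: T] f.
Hypothesis f0 : forall x, (0 <= f x)%R.

Let density_measure0 : density_measure mf f0 set0 = 0.
Proof. by rewrite /density_measure integral_set0. Qed.

Let density_measure_ge0 A : 0 <= density_measure mf f0 A.
Proof. by apply: integral_ge0 => x _; rewrite lee_fin. Qed.

Let density_measure_sigma_additive : semi_sigma_additive (density_measure mf f0).
Proof.
move=> F mF tF mUF; rewrite [X in _ --> X]ge0_integral_bigcup//; last 2 first.
- by apply/measurable_EFinP; exact: measurable_funTS.
- by move=> x _; rewrite lee_fin.
apply: is_cvg_ereal_nneg_natsum_cond => n _ _.
by apply: integral_ge0 => x _; rewrite lee_fin.
Qed.

HB.instance Definition _ := isMeasure.Build _ _ _ (density_measure mf f0)
  density_measure0 density_measure_ge0 density_measure_sigma_additive.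

End density_measure.

Lemma prode_fin_num {R : realType} (I : Type) (r : seq I) (Q : pred I) (F : I ->
  \bar R) :
  (forall i, F i \is a fin_num) -> (\big[mule/1]_(i <- r | Q i) F i)%E \is a fin_num.
Proof.
move=> Ffin; apply: (big_ind (fun x : \bar R => x \is a fin_num)) => // x y.
exact: fin_numM.
Qed.

Lemma mule_rot {R : realType} (a b c e b' c' e' : \bar R) :
  b = b' -> c = c' -> e = e' -> (a * ((b * c) * e) = (a * (c' * e')) * b')%E.
Proof. by move=> -> -> ->; rewrite -[in RHS]muleA [in RHS](muleC (c' * e')%E)
  -muleA. Qed.

Section likelihood_ratio.
Context {R : realType} {K : nat} {sigma : R}.
Context {d : measure_display} {S : measurableType d} {nu : probability S R}.
Context {d' : measure_display} {Omega : measurableType d'}.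
Context {P : ('I_K -> R) -> probability Omega R}.
Context {U : Omega -> S} {X : 'I_K -> nat -> Omega -> R}.
Hypothesis sigma0 : 0 < sigma.
Hypothesis model : gaussian_bandit sigma nu P U X.
Implicit Types (mu lambda : 'I_K -> R) (p : 'I_K -> nat).

Definition rectangle (A : set S) (B : 'I_K -> nat -> set R) (N : nat) :=
  U @^-1` A `&` [set omega | forall i n, (n < N)%N -> B i n (X i n omega)].

Lemma measurable_seed_preimage A : measurable A -> measurable (U @^-1` A).
Proof.
by move=> mA; rewrite -[X in measurable X]setTI; exact: (measurable_seed model).
Qed.

Lemma measurable_rectangle A B N : measurable A ->
  (forall i n, measurable (B i n)) -> measurable (rectangle A B N).
Proof.
move=> mA mB; apply: measurableI.
  exact: measurable_seed_preimage.
rewrite (_ : [set _ | _] =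
  \bigcap_(i in [set: 'I_K]) \bigcap_(n in `I_N) X i n @^-1` B i n).
  apply: fin_bigcap_measurable => // i _; apply: fin_bigcap_measurable => // n _.
  by rewrite -[X in measurable X]setTI; exact: (measurable_reward model).
by apply/seteqP; split=> [w h i _ n /= nN|w h i n nN]; [exact: h|exact: (h i)].
Qed.

Definition likelihood_ratio mu lambda (l : seq ('I_K * nat)) (w : Omega) : R :=
  \prod_(c <- l) gauss_lr R sigma (mu c.1) (lambda c.1) (X c.1 c.2 w).

Lemma likelihood_ratio_ge0 mu lambda l w : 0 <= likelihood_ratio mu lambda l w.
Proof. by apply: prodr_ge0 => c _; exact: expR_ge0. Qed.

Lemma measurable_likelihood_ratio mu lambda l :
  measurable_fun [set: Omega] (likelihood_ratio mu lambda l).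
Proof.
elim: l => [|c l IH].
  rewrite (_ : likelihood_ratio _ _ _ = cst 1) //.
  by apply/funext => w; rewrite /likelihood_ratio big_nil.
rewrite (_ : likelihood_ratio _ _ _ = (fun w =>
  gauss_lr R sigma (mu c.1) (lambda c.1) (X c.1 c.2 w) *
  likelihood_ratio mu lambda l w)).
  apply: measurable_funM => //.
  apply: measurableT_comp; first exact: measurable_gauss_lr.
  exact: (measurable_reward model).
by apply/funext => w; rewrite /likelihood_ratio big_cons.
Qed.

Lemma likelihood_ratio_sqr mu lambda l w :
  likelihood_ratio mu lambda l w ^+ 2 =
  expR (\sum_(c <- l) (lambda c.1 - mu c.1) ^+ 2 / sigma ^+ 2) *
  likelihood_ratio mu (fun i => 2 * lambda i - mu i) l w.
Proof.
rewrite /likelihood_ratio -prodrXl expR_sum -big_split/=.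
by apply: eq_bigr => c _; rewrite gauss_lr_sqr.
Qed.

Let tilt_mean mu lambda (l : seq ('I_K * nat)) i n :=
  if (i, n) \in l then lambda i else mu i.

Let upd (B : 'I_K -> nat -> set R) (c : 'I_K * nat) B' i n : set R :=
  if (i, n) == c then B' else B i n.

(* By induction on the tilted coordinates: under P mu weighted by the likelihood
   ratio of the other coordinates, X i0 n0 still has its normal law and is
   independent of the rest of the rectangle. *)
Lemma tilt_rectangle mu lambda (l : seq ('I_K * nat)) N A B :
  uniq l -> all (fun c => c.2 < N)%N l ->
  measurable A -> (forall i n, measurable (B i n)) ->
  (\int[P mu]_(w in rectangle A B N) (likelihood_ratio mu lambda l w)%:E =
   P mu (U @^-1` A) * \big[mule/1]_(i < K) \big[mule/1]_(n < N)
     normal_prob (tilt_mean mu lambda l i n) sigma (B i n))%E.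
Proof.
elim: l A B => [|c l IH] A B.
  move=> _ _ mA mB; rewrite (eq_integral (cst 1%E)); last first.
    by move=> w _; rewrite /likelihood_ratio big_nil.
  rewrite integral_cst; last exact: measurable_rectangle.
  rewrite mul1e; apply: etrans (mutual_independence model mu N mA mB) _.
  congr (_ * _)%E.
  by apply: eq_bigr => i _; apply: eq_bigr => n _; rewrite (law_of_reward model).
case: c => i0 n0 /= /andP[cl ul] /andP[n0N lN] mA mB.
(* [B1] frees the coordinate [(i0, n0)]: a rectangle with any side [B'] there is this freed
   rectangle cut by an event on [X i0 n0] alone. *)
pose B1 := upd B (i0, n0) [set: R].
have mB1 i n : measurable (B1 i n) by rewrite /B1 /upd; case: ifP.
have mR1 : measurable (rectangle A B1 N) by exact: measurable_rectangle.
have mX : measurable_fun (U := measurableTypeR R) [set: Omega] (X i0 n0)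
  by exact: (measurable_reward model).
have RE B' : rectangle A (upd B (i0, n0) B') N =
    rectangle A B1 N `&` X i0 n0 @^-1` B'.
  apply/seteqP; split=> [w [wA h]|w [[wA h] wB]].
    split; first split=> //.
      move=> i n nN; have := h i n nN; rewrite /B1 /upd.
      by case: ifP.
    by have := h i0 n0 n0N; rewrite /upd eqxx.
  split=> // i n nN; have := h i n nN; rewrite /B1 /upd.
  by case: eqP => // -[-> ->].
have BE : upd B (i0, n0) (B i0 n0) = B.
  by apply/funext => i; apply/funext => n; rewrite /upd; case: eqP => // -[-> ->].
pose rest : \bar R := (P mu (U @^-1` A) *
  ((\big[mule/1]_(n < N | n != Ordinal n0N) 
     normal_prob (tilt_mean mu lambda l i0 n) sigma (B i0 n)) *
   \big[mule/1]_(i < K | i != i0) \big[mule/1]_(n < N)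
     normal_prob (tilt_mean mu lambda l i n) sigma (B i n)))%E.
have restE (g : 'I_K -> nat -> R) B' :
    (forall i n, (i, n) != (i0, n0) -> g i n = tilt_mean mu lambda l i n) ->
  (P mu (U @^-1` A) * \big[mule/1]_(i < K) \big[mule/1]_(n < N)
     normal_prob (g i n) sigma (upd B (i0, n0) B' i n) =
   rest * normal_prob (g i0 n0) sigma B')%E.
  move=> gE; rewrite (bigD1 i0)//= (bigD1 (Ordinal n0N))//=.
  apply: mule_rot; first by rewrite /upd eqxx.
    apply: eq_bigr => n; rewrite -val_eqE /= => nn0.
    have inc : (i0, val n) != (i0, n0) by rewrite xpair_eqE eqxx.
    by rewrite gE// /upd (negbTE inc).
  apply: eq_bigr => i ii0; apply: eq_bigr => n _.
  have inc : (i, val n) != (i0, n0) by rewrite xpair_eqE (negbTE ii0).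
  by rewrite gE// /upd (negbTE inc).
have rest_fin : rest \is a fin_num.
  apply: fin_numM; first by apply: fin_num_measure; exact: measurable_seed_preimage.
  have H m i n : normal_prob m sigma (B i n) \is a fin_num.
    by apply: fin_num_measure; exact: mB.
  apply: fin_numM; first by apply: prode_fin_num => n; exact: H.
  by apply: prode_fin_num => i; apply: prode_fin_num => n; exact: H.
have rest0 : 0 <= fine rest.
  apply: fine_ge0; apply: mule_ge0; first exact: measure_ge0.
  apply: mule_ge0; first by apply: prode_ge0 => n _.
  by apply: prode_ge0 => i _; apply: prode_ge0 => n _.
have indic_preimage B' w : \1_(X i0 n0 @^-1` B') w = \1_B' (X i0 n0 w) :> R by [].
have indE B' w : \1_(rectangle A B1 N `&` X i0 n0 @^-1` B') w =
    \1_(rectangle A B1 N) w * \1_B' (X i0 n0 w) :> R.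
  by rewrite indicI.
(* [D] is [P mu] restricted to the freed rectangle and weighted by the ratio of the remaining
   coordinates; only its image under [X i0 n0] matters for the last factor. *)
pose f w := \1_(rectangle A B1 N) w * likelihood_ratio mu lambda l w.
have mf : measurable_fun [set: Omega] f.
  apply: measurable_funM; last exact: measurable_likelihood_ratio.
  exact: measurable_indic.
have f0 w : 0 <= f w by rewrite mulr_ge0 ?likelihood_ratio_ge0.
pose D := density_measure (P mu) _ mf f0.
pose g x : \bar R := (\1_(B i0 n0) x * gauss_lr R sigma (mu i0) (lambda i0) x)%:E.
have mg : measurable_fun [set: R] g.
  apply/measurable_EFinP; apply: measurable_funM; last exact: measurable_gauss_lr.
  exact: measurable_indic.
have g0 x : (0 <= g x)%E by rewrite lee_fin mulr_ge0 ?expR_ge0.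
have -> : (\int[P mu]_(w in rectangle A B N) (likelihood_ratio mu lambda ((i0, n0)
  :: l) w)%:E =
    \int[D]_w g (X i0 n0 w))%E.
  rewrite (@ge0_integral_density _ _ _ (P mu) D f)//; last first.
    exact: measurableT_comp.
  rewrite [LHS]integral_mkcond; apply: eq_integral => w _.
  rewrite -BE RE epatch_indic -EFinM /g /f -!EFinM; congr _%:E.
  by rewrite /likelihood_ratio big_cons/= indE; ring.
rewrite -[LHS](@ge0_integral_pushforward _ _ _ (measurableTypeR R) _ _ mX D setT g)//.
pose D' := measure_function_pushforward__canonical__measure_function_Measure D mX.
rewrite -[LHS]/(\int[D']_y g y)%E.
have m0 : normal_pdf (mu i0) sigma = normal_pdf (tilt_mean mu lambda l i0 n0) sigma.
  by rewrite /tilt_mean (negbTE cl).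
(* The induction hypothesis, used for every side [B'], says that the image law [D'] is [rest] times
   the normal law of mean [mu i0], since [(i0, n0)] is not in [l]. *)
rewrite (@ge0_integral_density _ _ _ lebesgue_measure D'
  (fun x => fine rest * normal_pdf (mu i0) sigma x))//; last 3 first.
- by apply: measurable_funM => //; exact: measurable_normal_pdf.
- by move=> x; rewrite mulr_ge0 ?normal_pdf_ge0.
- move=> B' mB'.
  transitivity (\int[P mu]_(w in rectangle A (upd B (i0, n0) B') N)
      (likelihood_ratio mu lambda l w)%:E)%E.
    rewrite RE [LHS]integral_mkcond [RHS]integral_mkcond.
    apply: eq_integral => w _; rewrite !epatch_indic -!EFinM; congr _%:E.
    by rewrite /f indE [\1_(_ @^-1` _) w]indic_preimage; ring.
  rewrite IH//; last by move=> i n; rewrite /upd; case: ifP.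
  rewrite restE// /normal_prob -m0 -{1}(fineK rest_fin).
  under [RHS]eq_integral do rewrite EFinM.
  rewrite [RHS]ge0_integralZl//.
  + by apply/measurable_EFinP/measurable_funTS; exact: measurable_normal_pdf.
  + by move=> x _; rewrite lee_fin normal_pdf_ge0.
have := restE (tilt_mean mu lambda ((i0, n0) :: l)) (B i0 n0); rewrite BE => ->;
  last first.
  by move=> i n inc; rewrite /tilt_mean inE (negbTE inc).
rewrite /tilt_mean inE eqxx/= -{2}(fineK rest_fin).
transitivity (\int[lebesgue_measure]_x ((fine rest)%:E *
   ((fun y => (normal_pdf (lambda i0) sigma y)%:E) \_ (B i0 n0)) x))%E.
  apply: eq_integral => x _; rewrite epatch_indic /g -!EFinM; congr _%:E.
  by rewrite -(normal_pdf_lr _ _ sigma0 (mu i0) (lambda i0)); ring.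
rewrite ge0_integralZl//.
- by rewrite -integral_mkcond.
- apply: (measurable_restrictT _ _).1; first exact: (mB i0 n0).
  by apply/measurable_funTS/measurable_EFinP; exact: measurable_normal_pdf.
- by move=> x _; apply: erestrict_ge0 => // y _; rewrite lee_fin normal_pdf_ge0.
Qed.
End likelihood_ratio.

(** * Events determined by finitely many samples *)

Section known_events.
Context {R : realType} {K : nat} {sigma : R}.
Context {d : measure_display} {S : measurableType d} {nu : probability S R}.
Context {d' : measure_display} {Omega : measurableType d'}.
Context {P : ('I_K -> R) -> probability Omega R}.
Context {U : Omega -> S} {X : 'I_K -> nat -> Omega -> R}.
Hypothesis sigma0 : 0 < sigma.
Hypothesis model : gaussian_bandit sigma nu P U X.
Implicit Types (mu lambda : 'I_K -> R) (p : 'I_K -> nat).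

(** These events are closed under intersection, so two finite measures that agree on them agree on
    all that the seed and the first [p i] rewards of each arm [i] determine. *)
Definition known_rectangles p : set (set Omega) :=
  [set E | exists A B, [/\ measurable A, forall i n, measurable (B i n) &
    E = U @^-1` A `&` [set w | forall i n, (n < p i)%N -> B i n (X i n w)]]].

Definition known p : set (set Omega) := <<s known_rectangles p>>.

Definition coords p : seq ('I_K * nat) :=
  [seq (i, n) | i <- enum 'I_K, n <- iota 0 (p i)].

Lemma mem_coords p i n : ((i, n) \in coords p) = (n < p i)%N.
Proof.
apply/allpairsPdep/idP => [[j [m [_]]]|npi].
  by rewrite mem_iota add0n => /andP[_ h] [-> ->].
by exists i, n; rewrite mem_enum mem_iota.
Qed.

Lemma uniq_coords p : uniq (coords p).
Proof.
apply: allpairs_uniq_dep; first exact: enum_uniq.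
- by move=> i _; exact: iota_uniq.
- by move=> [i n] [j m] _ _ /= [-> ->].
Qed.

Lemma sum_coords p (F : 'I_K -> R) :
  \sum_(c <- coords p) F c.1 = \sum_i (p i)%:R * F i.
Proof.
rewrite /coords big_allpairs_dep/= big_enum/=; apply: eq_bigr => i _.
by rewrite big_const_seq count_predT size_iota iter_addr_0 mulr_natl.
Qed.

(** Independence is stated for the same number of samples of every arm; lengths that depend on the
    arm are reached by padding with trivial sides. *)
Lemma known_rectanglesE p N A B : (forall i, (p i <= N)%N) ->
  U @^-1` A `&` [set w | forall i n, (n < p i)%N -> B i n (X i n w)] =
  rectangle A (fun i n => if (n < p i)%N then B i n else setT) N
    (U := U) (X := X).
Proof.
move=> pN; apply/seteqP; split=> w [wA h]; split=> // i n.
  by case: ifP => // + _; exact: h.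
by move=> npi; have := h i n (leq_trans npi (pN i)); rewrite npi.
Qed.

Lemma known_rectangles_bound p : forall i, (p i <= \sum_j p j)%N.
Proof. by move=> i; rewrite (bigD1 i)//= leq_addr. Qed.

Lemma known_measurable p E : known p E -> measurable E.
Proof.
apply: smallest_sub; first exact: sigma_algebra_measurable.
move=> _ [A [B [mA mB ->]]].
rewrite (@known_rectanglesE _ (\sum_j p j))//; last exact: known_rectangles_bound.
by apply: (measurable_rectangle model) => // i n; case: ifP.
Qed.

(** Change of measure. Both sides are measures in [E], they agree on rectangles by [tilt_rectangle],
    and the law of the seed is common to all instances. *)
Lemma known_likelihood mu lambda p E : known p E ->
  P lambda E =
  (\int[P mu]_(w in E) (likelihood_ratio (sigma := sigma) (X := X) mu lambda
    (coords p) w)%:E)%E.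
Proof.
move=> kE; pose m2 := density_measure (P mu) _
  (measurable_likelihood_ratio model mu lambda (coords p))
  (likelihood_ratio_ge0 mu lambda (coords p)).
rewrite -[RHS]/(m2 E).
apply: (g_sigma_algebra_measure_unique (known_rectangles p) _ (fun=> setT)) kE.
- by move=> F kF; apply: (@known_measurable p); exact: sub_sigma_algebra.
- move=> _; exists setT, (fun _ _ => setT); split => //.
  by apply/seteqP; split.
- by rewrite bigcup_const.
- move=> _ _ [A [B [mA mB ->]]] [A' [B' [mA' mB' ->]]].
  exists (A `&` A'), (fun i n => B i n `&` B' i n); split.
  + exact: measurableI.
  + by move=> i n; exact: measurableI.
  + apply/seteqP; split=> w; first by move=> [[? h] [? h']]; split => // i n npi;
    split; [exact: h|exact: h'].
    by move=> [[? ?] h]; split; split => // i n npi; case: (h i n npi).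
- move=> _ [A [B [mA mB ->]]].
  have pN := known_rectangles_bound p.
  rewrite (known_rectanglesE _ _ _ _ pN) /m2 /density_measure.
  have mB2 i n : measurable (if (n < p i)%N then B i n else setT) by case: ifP.
  have lN : all (fun c => c.2 < \sum_j p j)%N (coords p).
    by apply/allP => -[i n]; rewrite mem_coords/= => /leq_trans; exact.
  apply: etrans _ (esym (tilt_rectangle sigma0 model mu lambda _ _ _ _
    (uniq_coords p) lN mA mB2)).
  apply: etrans (mutual_independence model lambda _ mA mB2) _; congr (_ * _)%E.
    by rewrite !(law_of_seed model).
  apply: eq_bigr => i _; apply: eq_bigr => n _.
  rewrite (law_of_reward model); last exact: mB2.
  rewrite mem_coords; case: (n < p i)%N; first by [].
  (* On the padded coordinates the means may differ, but both laws give mass 1 to the whole line. *)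
  exact: etrans (probability_setT (normal_prob (lambda i) sigma))
    (esym (probability_setT (normal_prob (mu i) sigma))).
- move=> _; rewrite -[X in (X < _)%E]/(P lambda setT) probability_setT; exact: ltry.
Qed.

End known_events.

(** * Transport of probabilities between instances *)

Section transport_known.
Context {R : realType} {K : nat} {sigma : R}.
Context {d : measure_display} {S : measurableType d} {nu : probability S R}.
Context {d' : measure_display} {Omega : measurableType d'}.
Context {P : ('I_K -> R) -> probability Omega R}.
Context {U : Omega -> S} {X : 'I_K -> nat -> Omega -> R}.
Hypothesis sigma0 : 0 < sigma.
Hypothesis model : gaussian_bandit sigma nu P U X.
Implicit Types (mu lambda : 'I_K -> R) (p : 'I_K -> nat).
Let LR := likelihood_ratio (sigma := sigma) (X := X).

(** Each probability becomes an integral under the single law [P mu], so that [transport_piece]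
    reduces to a pointwise inequality. *)
Lemma integral_known mu lambda p E c : 0 <= c -> known (U := U) (X := X) p E ->
  (\int[P mu]_w (c * (\1_E w * LR mu lambda (coords p) w))%:E =
   (c * fine (P lambda E))%:E)%E.
Proof.
move=> c0 kE.
have mE : measurable E by exact: (known_measurable model _ _ kE).
under eq_integral do rewrite EFinM.
rewrite ge0_integralZl//.
- rewrite EFinM fineK ?fin_num_measure// (known_likelihood sigma0 model mu lambda _
  _ kE).
  rewrite [in RHS]integral_mkcond; congr (_ * _)%E; apply: eq_integral => w _.
  by rewrite epatch_indic -EFinM mulrC.
- apply/measurable_EFinP; apply: measurable_funM; first exact: measurable_indic.
  exact: (measurable_likelihood_ratio model).
- by move=> w _; rewrite lee_fin mulr_ge0// likelihood_ratio_ge0.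
Qed.

Lemma integral_cst_indic mu (E : set Omega) c : 0 <= c -> measurable E ->
  (\int[P mu]_w (c * \1_E w)%:E = (c * fine (P mu E))%:E)%E.
Proof.
move=> c0 mE; under eq_integral do rewrite EFinM.
rewrite ge0_integralZl//.
- by rewrite EFinM fineK ?fin_num_measure// integral_indic// setIT.
- by apply/measurable_EFinP; exact: measurable_indic.
Qed.

(* The integral over E of 1_F (Z - 1) <= (t + (Z - 1)^2 / t) / 2, rearranged so
   that all the terms are nonnegative. *)
Lemma transport_piece mu lambda p E F t x : 0 < t ->
  known (U := U) (X := X) p E -> known (U := U) (X := X) p F -> F `<=` E ->
  \sum_i (p i)%:R * ((lambda i - mu i) ^+ 2 / sigma ^+ 2) <= x ->
  fine (P lambda F) + t^-1 * fine (P lambda E) <=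
  fine (P mu F) + (t / 2 + (2 * t)^-1) * fine (P mu E) +
  (2 * t)^-1 * expR x * fine (P (fun i => 2 * lambda i - mu i) E).
Proof.
move=> t0 kE kF FE sx.
have mE : measurable E by exact: (known_measurable model _ _ kE).
have mF : measurable F by exact: (known_measurable model _ _ kF).
have mZ l := measurable_likelihood_ratio model mu l (coords p).
have Z0 l w : 0 <= LR mu l (coords p) w by exact: likelihood_ratio_ge0.
have t0' : 0 <= t^-1 by rewrite invr_ge0 ltW.
have tt : t != 0 by rewrite gt_eqF.
have t2 : 0 <= (2 * t)^-1 by rewrite invr_ge0 mulr_ge0// ltW.
have t3 : 0 <= t / 2 by rewrite divr_ge0// ltW.
have mcI c (G : set Omega) : measurable G ->
    measurable_fun setT (fun w => (c * \1_G w)%:E : \bar R).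
  by move=> mG; apply/measurable_EFinP/measurable_funM => //; exact: measurable_indic.
have mcZ c l (G : set Omega) : measurable G ->
    measurable_fun setT (fun w => (c * (\1_G w * LR mu l (coords p) w))%:E : \bar R).
  move=> mG; apply/measurable_EFinP/measurable_funM => //.
  by apply/measurable_funM => //; exact: measurable_indic.
pose kappa := fun i => 2 * lambda i - mu i.
rewrite -(mul1r (fine (P lambda F))) -(mul1r (fine (P mu F))) -lee_fin !EFinD.
have e0 : 0 <= (2 * t)^-1 * expR x by rewrite mulr_ge0 ?expR_ge0.
have c0 : 0 <= t / 2 + (2 * t)^-1 by rewrite addr_ge0.
rewrite -(integral_known mu lambda p F _ ler01 kF).
rewrite -(integral_known mu lambda p E _ t0' kE).
rewrite -(integral_known mu kappa p E _ e0 kE).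
rewrite -(integral_cst_indic mu F _ ler01 mF) -(integral_cst_indic mu E _ c0 mE).
have I0 c (G : set Omega) w : 0 <= c -> (0 <= (c * \1_G w)%:E :> \bar R)%E.
  by move=> c_ge0; rewrite lee_fin mulr_ge0.
have cZ0 c l (G : set Omega) w : 0 <= c ->
    (0 <= (c * (\1_G w * LR mu l (coords p) w))%:E :> \bar R)%E.
  by move=> c_ge0; rewrite lee_fin mulr_ge0// mulr_ge0.
rewrite -[leLHS]ge0_integralD; [|exact: measurableT|by move=> w _; exact: cZ0|
  exact: mcZ|by move=> w _; exact: cZ0|exact: mcZ].
rewrite -[X in (_ <= X + _)%E]ge0_integralD; [|exact: measurableT|
  by move=> w _; exact: I0|exact: mcI|by move=> w _; exact: I0|exact: mcI].
rewrite -[leRHS]ge0_integralD; [|exact: measurableT|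
  by move=> w _; apply: adde_ge0; exact: I0|by apply: emeasurable_funD; exact: mcI|
  by move=> w _; exact: cZ0|exact: mcZ].
apply: ge0_le_integral => //.
- by move=> w _; apply: adde_ge0; exact: cZ0.
- by apply: emeasurable_funD; exact: mcZ.
- by apply: emeasurable_funD; [apply: emeasurable_funD; exact: mcI|exact: mcZ].
move=> w _; rewrite -!EFinD lee_fin.
have Zsq : LR mu lambda (coords p) w ^+ 2 <= expR x * LR mu kappa (coords p) w.
  rewrite likelihood_ratio_sqr// ler_wpM2r// ler_expR.
  by rewrite (sum_coords p (fun i => (lambda i - mu i) ^+ 2 / sigma ^+ 2)).
set z := LR mu lambda _ w in Zsq *.
(* Up to a positive factor the difference of the two sides is (z - 1 - t)^2 if [f = 1], and (z -
   1)^2 + t^2 if [f = 0]. *)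
have key f : f = 0 \/ f = 1 ->
  f * z + t^-1 * z <= f + (t / 2 + (2 * t)^-1) + (2 * t)^-1 * z ^+ 2.
  move=> hf; rewrite -subr_ge0.
  have -> : f + (t / 2 + (2 * t)^-1) + (2 * t)^-1 * z ^+ 2 - (f * z + t^-1 * z) =
     (2 * t)^-1 * ((z - 1) ^+ 2 + t ^+ 2 - 2 * t * f * (z - 1)).
    by field.
  apply: mulr_ge0 => //.
  have := sqr_ge0 (z - 1 - t); have := sqr_ge0 (z - 1); have := sqr_ge0 t.
  by case: hf => ->; nra.
have h := FE w.
rewrite !mul1r.
have [Ew|Ew] := pselect (E w); last first.
  have Fw : ~ F w by move=> /h.
  by rewrite !indicE !memNset// !mul0r !mulr0 !addr0.
rewrite [\1_E w]indicE mem_set// !mul1r mulr1.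
apply: (le_trans (key (\1_F w) _)).
  by rewrite indicE; case: (_ \in _); [right|left].
by rewrite lerD2l -mulrA ler_wpM2l.
Qed.

Lemma fine_measure_cover (I : finType) (m : probability Omega R) (E : I ->
  set Omega) F :
  (forall i, measurable (E i)) ->
  (forall i, measurable (F `&` E i)) ->
  (forall i j w, E i w -> E j w -> i = j) ->
  (forall w, exists i, E i w) ->
  fine (m F) = \sum_i fine (m (F `&` E i)).
Proof.
move=> mE mFE Ed Ec.
have {1}-> : F = \bigcup_(i in [set` enum I]) (F `&` E i).
  apply/seteqP; split=> [w Fw|w [i _ [//]]].
  by have [i Ei] := Ec w; exists i => //=; rewrite mem_enum.
rewrite measure_fin_bigcup//; last first.
  apply/trivIsetP => i j _ _ ij; apply/eqP/negP => /negP/set0P[w [[_ wi] [_ wj]]].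
  by move/eqP: ij; apply; exact: Ed wj.
rewrite -fsbig_seq ?enum_uniq// big_enum/= -sum_fine// => i _.
by rewrite fin_num_measure.
Qed.

(** Sum of [transport_piece] over a finite partition on whose cells the numbers of samples are
    deterministic: the partition has total mass 1 under all three instances. Here [expR x - 1]
    bounds the chi-square divergence, and the free parameter [t] takes the place of the
    Cauchy-Schwarz inequality. *)
Lemma transport (I : finType) mu lambda (p : I -> 'I_K -> nat) E F t x :
  0 < t ->
  (forall i, known (U := U) (X := X) (p i) (E i)) ->
  (forall i, known (U := U) (X := X) (p i) (F `&` E i)) ->
  (forall i j w, E i w -> E j w -> i = j) ->
  (forall w, exists i, E i w) ->
  (forall i w, E i w -> \sum_j (p i j)%:R * ((lambda j - mu j) ^+ 2 / sigma ^+ 2)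
    <= x) ->
  fine (P lambda F) <= fine (P mu F) + (t + (expR x - 1) / t) / 2.
Proof.
move=> t0 kE kFE Ed Ec sx.
have mE i : measurable (E i) by exact: (known_measurable model _ _ (kE i)).
have mFE i : measurable (F `&` E i) by exact: (known_measurable model _ _ (kFE i)).
pose kappa := fun i => 2 * lambda i - mu i.
have tot m : \sum_i fine (P m (E i)) = 1.
  have := @fine_measure_cover I (P m) E setT mE; rewrite probability_setT/= => ->//.
    by apply: eq_bigr => i _; rewrite setTI.
  by move=> i; rewrite setTI.
have : \sum_i (fine (P lambda (F `&` E i)) + t^-1 * fine (P lambda (E i))) <=
  \sum_i (fine (P mu (F `&` E i)) + (t / 2 + (2 * t)^-1) * fine (P mu (E i)) +
    (2 * t)^-1 * expR x * fine (P kappa (E i))).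
  apply: ler_sum => i _.
  (* The bound [sx] on the exponent is available only when the cell has a point; an empty cell
     contributes nothing. *)
  have [[w Ew]|Ei0] := pselect (exists w, E i w).
    by apply: transport_piece => //; exact: (sx i w).
  have -> : E i = set0 by apply/seteqP; split=> // w Ew; case: Ei0; exists w.
  by rewrite setI0 !measure0 /= !mulr0 !addr0.
rewrite !big_split/= -!mulr_sumr !tot !mulr1 -!fine_measure_cover// => h.
have -> : fine (P mu F) + (t + (expR x - 1) / t) / 2 =
  fine (P mu F) + (t / 2 + (2 * t)^-1) + (2 * t)^-1 * expR x - t^-1.
  by field; rewrite gt_eqF.
by rewrite lerBrDr.
Qed.
End transport_known.

(** * Measurability of the interaction *)

Section known_closure.
Context {R : realType} {K : nat} {sigma : R}.
Context {d : measure_display} {S : measurableType d} {nu : probability S R}.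
Context {d' : measure_display} {Omega : measurableType d'}.
Context {P : ('I_K -> R) -> probability Omega R}.
Context {U : Omega -> S} {X : 'I_K -> nat -> Omega -> R}.
Hypothesis model : gaussian_bandit sigma nu P U X.
Implicit Types (p q : 'I_K -> nat) (E F : set Omega).
Let Known p := g_sigma_algebraType (known_rectangles (U := U) (X := X) p).
Local Notation known := (known (U := U) (X := X)).

Lemma known0 p : known p set0. Proof. exact: (@measurable0 _ (Known p)). Qed.

Lemma knownI p E F : known p E -> known p F -> known p (E `&` F).
Proof. exact: (@measurableI _ (Known p)). Qed.

Lemma knownD p E F : known p E -> known p F -> known p (E `\` F).
Proof. exact: (@measurableD _ (Known p)). Qed.

Lemma known_bigcup p (I : countType) (E : I -> set Omega) :
  (forall i, known p (E i)) -> known p (\bigcup_i E i).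
Proof. exact: (@countable_bigcupT_measurable _ (Known p)). Qed.

Lemma known_seed p A : measurable A -> known p (U @^-1` A).
Proof.
move=> mA; apply: sub_sigma_algebra; exists A, (fun _ _ => setT); split => //.
by apply/seteqP; split=> w //; case.
Qed.

Lemma known_reward p i n B : (n < p i)%N -> measurable B -> known p (X i n @^-1` B).
Proof.
move=> npi mB; apply: sub_sigma_algebra.
exists setT, (fun j m => if (j, m) == (i, n) then B else setT); split => //.
  by move=> j m; case: ifP.
apply/seteqP; split=> w.
  by move=> wB; split=> // j m _; case: eqP => // -[-> ->].
by case=> _ /(_ i n npi); rewrite eqxx.
Qed.

Lemma known_mono p q E : (forall i, (q i <= p i)%N) -> known q E -> known p E.
Proof.
move=> qp; apply: smallest_sub; first exact: smallest_sigma_algebra.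
move=> _ [A [B [mA mB ->]]]; apply: sub_sigma_algebra.
exists A, (fun i n => if (n < q i)%N then B i n else setT); split => //.
  by move=> i n; case: ifP.
apply/seteqP; split=> w [wA h]; split=> // i n.
  by move=> _; case: ifP => //; exact: h.
by move=> nq; have := h i n (leq_trans nq (qp i)); rewrite nq.
Qed.

End known_closure.

Section history_measurability.
Context {R : realType} {K : nat}.
Implicit Types h : history R K.

Lemma batch_sizes_rcons h b :
  batch_sizes (rcons h b) = rcons (batch_sizes h) [ffun i => size (b i)].
Proof. by rewrite /batch_sizes map_rcons. Qed.

Lemma pulls_rcons h b i : pulls (rcons h b) i = (pulls h i + size (b i))%N.
Proof. by rewrite /pulls -cats1 big_cat/= big_seq1. Qed.

Lemma sample_rcons h (b : {ffun 'I_K -> seq R}) j i m : sample (rcons h b) j i m =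
  if (j < size h)%N then sample h j i m
  else if j == size h then nth 0 (b i) m else 0.
Proof.
rewrite /sample nth_rcons; case: ifP => // _; case: ifP => // _.
by rewrite ffunE nth_nil.
Qed.

Lemma measurable_batch_sizes s :
  measurable ([set h | batch_sizes h = s] : set (mhistory R K)).
Proof. by apply: sub_sigma_algebra; left; exists s. Qed.

Lemma measurable_sample b i m : measurable_fun [set: mhistory R K]
  ((fun h => sample h b i m) : mhistory R K -> R).
Proof.
move=> _ B mB; rewrite setTI; apply: sub_sigma_algebra; right.
by exists b, i, m, B.
Qed.
End history_measurability.

Section run_measurability.
Context {R : realType} {K : nat} {sigma : R} {ans : {set {set 'I_K}}}.
Context {d : measure_display} {S : measurableType d}.
Variable alg : batched_algorithm R ans S.
Context {d' : measure_display} {Omega : measurableType d'}.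
Context {P : ('I_K -> R) -> probability Omega R}.
Context {U : Omega -> S} {X : 'I_K -> nat -> Omega -> R}.
Implicit Types (p q : 'I_K -> nat) (E F : set Omega).
Local Notation known := (known (U := U) (X := X)).
Local Notation run := (run alg U X).

Lemma size_run w r : size (run w r) = r.
Proof. by elim: r => //= r IH; rewrite size_rcons IH. Qed.

Lemma pulls_run_S w r i : pulls (run w r.+1) i =
  (pulls (run w r) i + batch_size alg (U w) (run w r) i)%N.
Proof. by rewrite /= pulls_rcons ffunE size_map size_iota. Qed.

Lemma pulls_run_mono w r r' i : (r <= r')%N ->
  (pulls (run w r) i <= pulls (run w r') i)%N.
Proof.
move=> rr'; rewrite -(subnKC rr'); elim: (r' - r)%N => [|n IH].
  by rewrite addn0.
by rewrite addnS pulls_run_S (leq_trans IH)// leq_addr.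
Qed.

Lemma batch_sizes_run_S w r : batch_sizes (run w r.+1) =
  rcons (batch_sizes (run w r)) (batch_size alg (U w) (run w r)).
Proof.
rewrite /= batch_sizes_rcons; congr rcons; apply/ffunP => i.
by rewrite !ffunE size_map size_iota.
Qed.

(** Each batch size is a function of the seed and of earlier samples, so once the pull counts are
    fixed the history involves those samples only. By induction on [r], splitting over the countably
    many pull counts [q] before the last batch. *)
Lemma known_run r p (B : set (S * mhistory R K)) : measurable B ->
  known p [set w | (forall i, pulls (run w r) i = p i) /\ B (U w, run w r)].
Proof.
elim: r p B => [|r IH] p B mB.
  have [p0|p0] := pselect (forall i, p i = 0%N); last first.
    rewrite (_ : [set _ | _] = set0); first exact: known0.
    apply/seteqP; split=> // w [h _]; apply: p0 => i.
    by rewrite -h /pulls big_nil.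
  rewrite (_ : [set _ | _] = U @^-1` (ysection B [::])).
    by apply: known_seed; exact: measurable_ysection.
  apply/seteqP; split=> w /=; first by case=> _; rewrite /ysection/= inE.
  by rewrite /ysection/= inE => Bw; split=> // i; rewrite p0 /pulls big_nil.
rewrite (_ : [set _ | _] = \bigcup_(q : {ffun 'I_K -> nat})
  [set w | (forall i, pulls (run w r) i = q i) /\
     (forall i, pulls (run w r.+1) i = p i) /\ B (U w, run w r.+1)]); last first.
  apply/seteqP; split=> [w h|w [q _ [_ h]]//].
  by exists [ffun i => pulls (run w r) i] => //; split=> // i; rewrite ffunE.
apply: known_bigcup => q.
have [qp|qp] := pselect (forall i, (q i <= p i)%N); last first.
  rewrite (_ : [set _ | _] = set0); first exact: known0.
  apply/seteqP; split=> // w [hq [hp _]]; apply: qp => i.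
  by rewrite -hq -hp pulls_run_mono.
pose n := [ffun i => p i - q i]%N.
(* On [D] the last batch has the deterministic size [n]: for arm [i] it consists of the rewards of
   indices [q i] to [p i - 1]. *)
pose D := [set w | (forall i, pulls (run w r) i = q i) /\
                   batch_size alg (U w) (run w r) = n].
have kD (B' : set (S * mhistory R K)) : measurable B' ->
  known p (D `&` [set w | B' (U w, run w r)]).
  move=> mB'; apply: (@known_mono _ _ _ _ _ _ _ _ p q) => //.
  rewrite (_ : _ `&` _ = [set w | (forall i, pulls (run w r) i = q i) /\
    ([set sh | batch_size alg sh.1 sh.2 = n] `&` B') (U w, run w r)]).
    by apply: IH; apply: measurableI => //; exact: measurable_batch_size.
  by apply/seteqP; split=> w /=; rewrite /D /=; tauto.
have kDT : known p D by have := kD setT measurableT; rewrite setIT.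
have -> : [set w | (forall i, pulls (run w r) i = q i) /\
     (forall i, pulls (run w r.+1) i = p i) /\ B (U w, run w r.+1)] =
   D `&` [set w | B (U w, run w r.+1)].
  apply/seteqP; split=> w /=.
    case=> hq [hp hB]; split=> //; split=> //; apply/ffunP => i.
    by rewrite ffunE -hp -hq pulls_run_S addKn.
  case=> -[hq hn] hB; split=> //; split=> // i.
  by rewrite pulls_run_S hn hq ffunE subnKC.
pose KT := g_sigma_algebraType (known_rectangles (U := U) (X := X) p).
suff mf : @measurable_fun _ _ KT (S * mhistory R K)%type D (fun w => (U w, run w r.+1)).
  exact: mf.
have mrun : @measurable_fun _ _ KT (mhistory R K) D (fun w => run w r.+1).
  apply: (@measurability _ _ KT (mhistory R K) D _ (@history_cylinders R K)) => //.
  move=> _ [_ [[s _ <-]|[j [i [m [B' [mB' ->]]]]]] <-].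
    case/lastP: s => [|s x].
      rewrite (_ : _ `&` _ = set0); first exact: known0.
      apply/seteqP; split=> // w [_]; rewrite /= batch_sizes_rcons.
      by move/(congr1 size); rewrite size_rcons.
    have [->|xn] := eqVneq x n; last first.
      rewrite (_ : _ `&` _ = set0); first exact: known0.
      apply/seteqP; split=> // w [[_ hn]];
        rewrite -[_ w]/(batch_sizes (run w r.+1) = rcons s x) batch_sizes_run_S.
      by move/rcons_inj => -[_]; rewrite hn => /eqP; rewrite eq_sym (negbTE xn).
    rewrite (_ : _ `&` _ = D `&` [set w | (snd @^-1` [set h : mhistory R K |
      batch_sizes h = s]) (U w, run w r)]).
      apply: kD; rewrite -[X in measurable X]setTI; apply: measurable_snd => //.
      exact: measurable_batch_sizes.
    apply/seteqP; split=> w [[hq hn] h]; split=> //; move: h.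
      rewrite -[_ w]/(batch_sizes (run w r.+1) = rcons s n) batch_sizes_run_S.
      by move/rcons_inj => -[].
    rewrite -[(_ @^-1` _) w]/(batch_sizes (run w r.+1) =
      rcons s n) batch_sizes_run_S hn.
    by rewrite /= => ->.
  (* An entry of the extended history is an entry of an earlier batch, a fresh reward, or the
     default value 0 of [nth] outside the range. *)
  have E w : D w -> sample (run w r.+1) j i m =
      if (j < r)%N then sample (run w r) j i m
      else if (j == r) && (m < n i)%N then X i (q i + m)%N w else 0.
    case=> hq hn; rewrite /= sample_rcons size_run; case: ifP => // _.
    case: ifP => // _; rewrite ffunE hn hq /=.
    have [mn|nm] := ltnP m (n i).
      by rewrite (nth_map 0%N) ?size_iota// nth_iota.
    by rewrite nth_default// size_map size_iota.
  have DE Q : (forall w, D w -> Q w <-> B' (sample (run w r.+1) j i m)) ->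
      known p (D `&` [set w | Q w]) ->
        known p (D `&` [set w | B' (sample (run w r.+1) j i m)]).
    move=> h; rewrite (_ : D `&` [set w | Q w] =
      D `&` [set w | B' (sample (run w r.+1) j i m)])//.
    by apply/seteqP; split=> w [Dw] /= /(h w Dw).
  case: (ltnP j r) E => jr E.
    apply: (DE (fun w => ((fun sh => sample sh.2 j i m) @^-1` B') (U w, run w r))).
      by move=> w /E ->.
    apply: kD; rewrite -[X in measurable X]setTI.
    have mc : measurable_fun setT ((fun h =>
      sample h j i m) \o (snd : S * mhistory R K -> mhistory R K)).
      by apply: measurableT_comp; [exact: measurable_sample|exact: measurable_snd].
    exact: mc.
  case: andP E => [[_ mn]|_] E.
    apply: (DE (X i (q i + m) @^-1` B')); first by move=> w /E ->.
    apply: knownI => //; apply: known_reward => //.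
    by move: mn; rewrite ffunE ltn_subRL.
  (* Out of range the entry is the constant 0, so the event is all of [D] or empty. *)
  have [B0|B0] := pselect (B' 0).
    apply: (DE setT); first by move=> w /E ->; split.
    by rewrite (_ : [set w | _] = setT)// setIT.
  apply: (DE set0); first by move=> w /E ->; split.
  by rewrite (_ : [set w | _] = set0)// setI0; exact: known0.
apply: (@measurability _ _ KT (S * mhistory R K)%type D _ _ erefl).
move=> _ [_ [[A mA <-]|[A mA <-]] <-].
  rewrite (_ : _ `&` _ = D `&` U @^-1` A).
    by apply: knownI => //; exact: known_seed.
  by apply/seteqP; split=> w /=; tauto.
rewrite (_ : _ `&` _ = D `&` (fun w => run w r.+1) @^-1` A); first exact: mrun.
by apply/seteqP; split=> w /=; tauto.
Qed.

End run_measurability.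

(** * Truncated runs *)

Section stopping.
Context {R : realType} {K : nat} {sigma : R} {ans : {set {set 'I_K}}}.
Context {d : measure_display} {S : measurableType d}.
Variable alg : batched_algorithm R ans S.
Context {d' : measure_display} {Omega : measurableType d'}.
Context {P : ('I_K -> R) -> probability Omega R}.
Context {U : Omega -> S} {X : 'I_K -> nat -> Omega -> R}.
Implicit Types (p q : 'I_K -> nat) (E F : set Omega).
Local Notation known := (known (U := U) (X := X)).
Local Notation run := (run alg U X).

(** The analogue of the sigma-algebra of a stopping time: the number of samples after [r] batches is
    random, so [Q] is tested only where it equals [p]. *)
Definition past r p (Q : set Omega) :=
  known p [set w | (forall i, pulls (run w r) i = p i) /\ Q w].

Lemma past_run r r' p (B : set (S * mhistory R K)) : (r' <= r)%N ->
  measurable B -> past r p [set w | B (U w, run w r')].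
Proof.
move=> rr' mB.
rewrite /past (_ : [set w | _] = \bigcup_(q : {ffun 'I_K -> nat})
  ([set w | (forall i, pulls (run w r') i = q i) /\ B (U w, run w r')] `&`
   [set w | (forall i, pulls (run w r) i = p i) /\ setT (U w, run w r)])); last first.
  apply/seteqP; split=> [w [hp hB]|w [q _ [[_ hB] [hp _]]]//].
  exists [ffun i => pulls (run w r') i] => //; split=> //.
  by split=> // i; rewrite ffunE.
apply: known_bigcup => q.
have [qp|qp] := pselect (forall i, (q i <= p i)%N).
  by apply: knownI; [apply: (@known_mono _ _ _ _ _ _ _ _ p q)|]; try exact: known_run.
rewrite (_ : _ `&` _ = set0); first exact: known0.
apply/seteqP; split=> // w [[hq _] [hp _]]; apply: qp => i.
by rewrite -hq -hp pulls_run_mono.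
Qed.

Lemma pastI r p Q Q' : past r p Q -> past r p Q' -> past r p (Q `&` Q').
Proof.
move=> h h'; have := knownI _ _ _ h h'; congr known.
by apply/seteqP; split=> w /=; tauto.
Qed.

Lemma pastT r p : past r p setT.
Proof. exact: (@known_run _ _ _ _ _ _ _ _ _ _ r p setT). Qed.

Lemma past0 r p : past r p set0.
Proof.
rewrite /past (_ : [set w | _] = set0); first exact: known0.
by apply/seteqP; split=> // w [].
Qed.

Lemma past_cst r p (Q : Prop) : past r p [set _ | Q].
Proof.
have [q|q] := pselect Q.
  by rewrite (_ : [set _ | _] = setT); [exact: pastT|apply/seteqP; split].
by rewrite (_ : [set _ | _] = set0); [exact: past0|apply/seteqP; split].
Qed.

Lemma pastC r p Q : past r p Q -> past r p (~` Q).
Proof.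
move=> h; have := knownD _ _ _ (pastT r p) h; congr known.
by apply/seteqP; split=> w /=; tauto.
Qed.

Lemma past_bigcup r p (I : countType) (Q : I -> set Omega) :
  (forall i, past r p (Q i)) -> past r p (\bigcup_i Q i).
Proof.
move=> h; have := known_bigcup _ _ _ h; congr known.
apply/seteqP; split=> [w [i _ [hp hQ]]|w [hp [i _ hQ]]]; last by exists i.
by split=> //; exists i.
Qed.

Lemma past_batch_size r p (Q : {ffun 'I_K -> nat} -> Prop) :
  past r p [set w | Q (batch_size alg (U w) (run w r))].
Proof.
rewrite (_ : [set w | _] = \bigcup_n ([set w |
    [set sh : S * mhistory R K | batch_size alg sh.1 sh.2 = n] (U w, run w r)]
    `&` [set _ | Q n])).
  apply: past_bigcup => n; apply: pastI; last exact: past_cst.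
  by apply: past_run => //; exact: measurable_batch_size.
apply/seteqP; split=> w /=; first by move=> hQ; exists (batch_size alg (U w) (run w r)).
by case=> n _ [/= -> hQ].
Qed.

Lemma past_decision r r' p a : (r' <= r)%N ->
  past r p [set w | decision alg (U w) (run w r') = a].
Proof.
move=> rr'; apply: (@past_run _ _ _ [set sh | decision alg sh.1 sh.2 = a]) => //.
exact: measurable_decision.
Qed.

Lemma past_measurable (model : gaussian_bandit sigma (seed_law alg) P U X) r Q :
  (forall p, past r p Q) -> measurable Q.
Proof.
move=> h; rewrite (_ : Q = \bigcup_(p : {ffun 'I_K -> nat})
    [set w | (forall i, pulls (run w r) i = p i) /\ Q w]).
  apply: countable_bigcupT_measurable; first exact: countableP.
  by move=> p; exact: (known_measurable model _ _ (h p)).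
apply/seteqP; split=> [w Qw|w [p _ []//]].
by exists [ffun i => pulls (run w r) i] => //; split=> // i; rewrite ffunE.
Qed.

Definition stopped r : set Omega := [set w | exists2 r', (r' <= r)%N & stops alg U
  X w r'].

(** Since [run] continues beyond the stopping time, [stops] may hold at several batches; the first
    one has to be singled out. *)
Definition stops_first r a : set Omega :=
  [set w | stops alg U X w r /\ (forall r', (r' < r)%N -> ~~ stops alg U X w r')] `&`
  [set w | decision alg (U w) (run w r) = a].

Lemma past_stops r r' p : (r' <= r)%N -> past r p [set w | stops alg U X w r'].
Proof.
move=> rr'; rewrite /stops; case: (0 < r')%N; last first.
  by rewrite (_ : [set w | _] = set0); [exact: past0|apply/seteqP; split].
rewrite (_ : [set w | _] = ~` [set w | decision alg (U w) (run w r') = None]).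
  by apply: pastC; exact: past_decision.
by apply/seteqP; split=> w /=; case: decision.
Qed.

Lemma past_stopped r r' p : (r' <= r)%N -> past r p (stopped r').
Proof.
move=> rr'.
rewrite (_ : stopped r' = \bigcup_j ([set _ | (j <= r')%N] `&` [set w | stops alg U
  X w j])).
  apply: past_bigcup => j; have [jr|jr] := leqP j r'.
    by apply: pastI; [exact: past_cst|apply: past_stops; exact: leq_trans rr'].
  by rewrite (_ : _ `&` _ = set0); [exact: past0|apply/seteqP; split=> // w []].
by apply/seteqP; split=> [w [j ? ?]|w [j _ [? ?]]]; exists j.
Qed.

Lemma past_stops_first r r' p a : (r' <= r)%N -> past r p (stops_first r' a).
Proof.
move=> rr'; apply: pastI; last exact: (past_decision _ _ _ _ rr').
rewrite (_ : [set w | _] = [set w | stops alg U X w r'] `&`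
   ~` \bigcup_j ([set _ | (j < r')%N] `&` [set w | stops alg U X w j])).
  apply: (pastI r p); first exact: (past_stops _ _ _ rr').
  apply: (pastC r p); apply: past_bigcup => j; have [jr|jr] := ltnP j r'.
    apply: pastI; [exact: past_cst|apply: past_stops].
    by rewrite (leq_trans (ltnW jr)).
  by rewrite (_ : _ `&` _ = set0); [exact: past0|apply/seteqP; split=> // w []].
apply/seteqP; split=> [w [sw h]|w [sw h]]; split=> //.
  by case=> j _ [/= /h /negP].
by move=> j jr; apply/negP => sj; apply: h; exists j.
Qed.

Local Notation N w r := (total_pulls (run w r)).

Lemma total_pulls_S w r :
  N w r.+1 = (N w r + \sum_i batch_size alg (U w) (run w r) i)%N.
Proof. by rewrite /total_pulls -big_split/=; apply: eq_bigr => i _;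
  exact: pulls_run_S. Qed.

Lemma total_pulls_mono w r r' : (r <= r')%N -> (N w r <= N w r')%N.
Proof. by move=> rr'; apply: leq_sum => i _; exact: pulls_run_mono. Qed.

Lemma total_pulls0 w : N w 0%N = 0%N.
Proof. by rewrite /total_pulls big1// => i _; rewrite /pulls big_nil. Qed.

(* The last batch, among the first k, at the end of which at most M samples
   have been taken, is r, with p samples of each arm. *)
Definition truncated k M r p : set Omega :=
  [set w | [/\ forall i, pulls (run w r) i = p i, (N w r <= M)%N &
               (r < k)%N -> (M < N w r.+1)%N]].

(** The total after batch [r.+1] depends on that batch only through its size, which is chosen before
    its samples are seen. This is where batching enters the argument. *)
Lemma known_truncated k M r p Q :
  past r p Q -> known p (Q `&` truncated k M r p).
Proof.
move=> pQ.
have := pastI _ _ _ _ pQ (past_batch_size r p (fun b => (\sum_i p i <= M)%N /\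
  ((r < k)%N -> (M < \sum_i p i + \sum_i b i)%N))).
have NE w : (forall i, pulls (run w r) i = p i) -> N w r = (\sum_i p i)%N.
  by move=> hp; apply: eq_bigr => i _; exact: hp.
congr known; apply/seteqP; split=> w /=.
  by case=> hp [hQ [h1 h2]]; split=> //; split=> //; rewrite ?total_pulls_S NE.
by case=> hQ [hp]; rewrite total_pulls_S NE.
Qed.

Context (sigma0 : 0 < sigma) (model : gaussian_bandit sigma (seed_law alg) P U X).

(** The sets [truncated k M r p] with [r <= k] and the entries of [p] at most [M] partition [Omega],
    since totals grow with [r] and start from 0. At most [M] samples are used on each, which bounds
    the exponent in [transport]. *)
Lemma transport_truncated mu lambda k M F t D x : 0 < t ->
  (forall r p, (r <= k)%N -> exists2 Q, past r p Q &
     F `&` truncated k M r p = Q `&` truncated k M r p) ->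
  (forall i, `|lambda i - mu i| <= D) -> M%:R * D ^+ 2 / sigma ^+ 2 <= x ->
  fine (P lambda F) <= fine (P mu F) + (t + (expR x - 1) / t) / 2.
Proof.
move=> t0 hF hD Mx.
pose I := ('I_k.+1 * {ffun 'I_K -> 'I_M.+1})%type.
pose pp (j : I) i := nat_of_ord (j.2 i).
pose E (j : I) := truncated k M j.1 (pp j).
apply: (@transport _ _ _ _ _ _ _ _ _ _ _ sigma0 model I mu lambda pp E F) => //.
- move=> j; rewrite -(setTI (E j)); apply: known_truncated; exact: pastT.
- move=> j; have [Q pQ ->] := hF j.1 (pp j) (ltn_ord j.1).
  exact: known_truncated.
- move=> [r p] [r' p'] w [/= hp hM hr] [/= hp' hM' hr'].
  have rr' : r = r'.
    apply/val_inj/eqP; rewrite eqn_leq /= leqNgt [X in _ && X]leqNgt.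
    apply/andP; split; apply/negP => h.
      have := hr' (leq_trans h (ltn_ord r)); rewrite ltnNge => /negP; apply.
      exact: leq_trans (total_pulls_mono w _ _ h) hM.
    have := hr (leq_trans h (ltn_ord r')); rewrite ltnNge => /negP; apply.
    exact: leq_trans (total_pulls_mono w _ _ h) hM'.
  rewrite -rr' in hp' *; congr pair; apply/ffunP => i; apply/val_inj.
  by rewrite -[val _]/(pp (r, p) i) -hp hp'.
- move=> w.
  have ex : exists r, (r <= k)%N && (N w r <= M)%N.
    by exists 0%N; rewrite total_pulls0.
  have bd r : (r <= k)%N && (N w r <= M)%N -> (r <= k)%N by case/andP.
  have [r /andP[rk rM] rmax] := ex_maxnP ex bd.
  have pM i : (pulls (run w r) i < M.+1)%N.
    by rewrite ltnS (leq_trans _ rM)// /total_pulls (bigD1 i)//= leq_addr.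
  exists (Ordinal (rk : (r < k.+1)%N), [ffun i => Ordinal (pM i)]).
  split=> //=; first by move=> i; rewrite /pp/= ffunE.
  move=> rk'; rewrite ltnNge; apply/negP => h.
  by have := rmax r.+1; rewrite rk' h => /(_ isT); rewrite ltnn.
- move=> j w [hp hM _]; apply: le_trans Mx.
  under eq_bigr do rewrite mulrA.
  rewrite -mulr_suml ler_pM2r ?invr_gt0 ?exprn_gt0//.
  apply: (@le_trans _ _ (\sum_i (pp j i)%:R * D ^+ 2)).
    apply: ler_sum => i _; rewrite ler_wpM2l//.
    by rewrite -[leLHS]real_normK ?num_real// lerXn2r// nnegrE// (le_trans _ (hD i)).
  rewrite -mulr_suml -natr_sum ler_wpM2r ?sqr_ge0// ler_nat (leq_trans _ hM)//.
  by apply: leq_sum => i _; rewrite -hp.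
Qed.

End stopping.

(** * Probability of stopping early *)

(** The integral of a nonnegative function is a supremum over the simple functions below it, hence
    monotone for arbitrary functions, such as [nb_samples] and [nb_batches]. *)
Lemma ge0_le_integral_nonmeasurable {d} {T : measurableType d} {R : realType}
    (m : {measure set T -> \bar R}) (f g : T -> \bar R) :
  (forall x, 0 <= f x)%E -> (forall x, f x <= g x)%E ->
  (\int[m]_x f x <= \int[m]_x g x)%E.
Proof.
move=> f0 fg; rewrite !ge0_integralTE//; last first.
  by move=> x; exact: le_trans (fg x).
by apply: le_ereal_sup => _ /= [h hf <-]; exists h => // x;
  exact: le_trans (hf x) (fg x).
Qed.

Section early_stopping.
Context {R : realType} {K : nat} {sigma : R} {pb : problem R}.
Context {d : measure_display} {S : measurableType d}.
Variable alg : batched_algorithm R (answers K pb) S.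
Context {d' : measure_display} {Omega : measurableType d'}.
Context {P : ('I_K -> R) -> probability Omega R}.
Context {U : Omega -> S} {X : 'I_K -> nat -> Omega -> R}.
Context (sigma0 : 0 < sigma) (model : gaussian_bandit sigma (seed_law alg) P U X).
Local Notation run := (run alg U X).
Local Notation N w r := (total_pulls (run w r)).
Local Notation stopped := (stopped alg (U := U) (X := X)).
Local Notation stops_first := (stops_first alg (U := U) (X := X)).
Local Notation pr m E := (fine (P m E)).

Lemma stops_first_stopping_batch r a w : stops_first r a w ->
  stopping_batch alg U X w = Some r.
Proof.
case=> -[sr h] _; rewrite /stopping_batch; case: pselect => [ex|]; last first.
  by case; exists r.
case: ex_minnP => n sn nmin; congr Some; apply/eqP.
rewrite eqn_leq nmin// leqNgt; apply/negP => /h.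
by rewrite sn.
Qed.

Lemma stopping_batchP w :
  (exists r, stopping_batch alg U X w = Some r /\
             stops_first r (decision alg (U w) (run w r)) w) \/
  stopping_batch alg U X w = None /\ forall r, ~~ stops alg U X w r.
Proof.
have [ex|nex] := pselect (exists r, stops alg U X w r).
  left; case: (ex_minnP ex) => n sn nmin; exists n.
  have sf : stops_first n (decision alg (U w) (run w n)) w.
    split => //; split=> // r rn; apply/negP => /nmin.
    by rewrite leqNgt rn.
  by split=> //; exact: stops_first_stopping_batch sf.
right; split; last by move=> r; apply/negP => sr; apply: nex; exists r.
by rewrite /stopping_batch; case: pselect => // ex.
Qed.

Lemma returned_answerP w A : returned_answer alg U X w = Some A <->
  exists r, stops_first r (Some A) w.
Proof.
split=> [|[r sf]].
  rewrite /returned_answer; have [[r [-> sf]]|[-> _]//] := stopping_batchP w.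
  by move=> <-; exists r.
by rewrite /returned_answer (stops_first_stopping_batch _ _ _ sf); case: sf.
Qed.

Lemma nb_samples_ge0 w : (0 <= nb_samples alg U X w)%E.
Proof. by rewrite /nb_samples; case: stopping_batch => [r|]; rewrite ?lee_fin. Qed.

(** A batch cannot be interrupted: without a stop after batch [j], batch [j.+1] is paid for in
    full. *)
Lemma nb_samples_ge w j : ~ stopped j w ->
  ((N w j.+1)%:R%:E <= nb_samples alg U X w)%E.
Proof.
move=> nsj; rewrite /nb_samples.
have [[r [-> [[sr _] _]]]|[-> _]] := stopping_batchP w; last exact: leey.
rewrite lee_fin ler_nat; apply: total_pulls_mono.
by rewrite ltnNge; apply/negP => rj; apply: nsj; exists r.
Qed.

(** The summand 1 is due to the first batch, before which no decision is taken. *)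
Lemma nb_batches_ge w k : (1 + (k%:R * \1_(~` stopped k) w)%:E <= nb_batches alg U
  X w)%E.
Proof.
rewrite /nb_batches.
have [[r [-> [[sr _] _]]]|[-> _]] := stopping_batchP w; last exact: leey.
have r0 : (0 < r)%N by move: sr; rewrite /stops; case/andP.
rewrite -EFinD lee_fin indicE; have [/set_mem ns|_] := boolP (w \in _).
  rewrite mulr1 nat1r ler_nat ltnNge; apply/negP => rk.
  by apply: ns; exists r.
by rewrite mulr0 addr0 ler1n.
Qed.

Lemma measurable_stopped k : measurable (stopped k).
Proof.
by apply: (past_measurable alg model k) => p; exact: past_stopped.
Qed.

Lemma measurable_stops_first r a : measurable (stops_first r a).
Proof.
by apply: (past_measurable alg model r) => p; exact: past_stops_first.
Qed.

Lemma measurable_total_pulls r (Q : nat -> Prop) :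
  measurable [set w | Q (N w r)].
Proof.
apply: (past_measurable alg model r) => p.
have := past_cst alg (U := U) (X := X) r p (Q (\sum_i p i)%N).
have NE w : (forall i, pulls (run w r) i = p i) -> N w r = (\sum_i p i)%N.
  by move=> hp; apply: eq_bigr => i _; exact: hp.
rewrite /past; congr known.
by apply/seteqP; split=> w [hp hQ]; split=> //; move: hQ; rewrite /= NE.
Qed.

(** Markov's inequality; exceeding [M] means reaching [M.+1], which is positive even for a zero
    budget. *)
Lemma markov_samples nu' j M c : (expected_samples alg P U X nu' <= c%:E)%E ->
  pr nu' [set w | ~ stopped j w /\ (M < N w j.+1)%N] <= c / M.+1%:R.
Proof.
move=> hc; set F := [set w | _].
have mF : measurable F.
  rewrite (_ : F = ~` stopped j `&` [set w | (M < N w j.+1)%N]) //.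
  by apply: measurableI; [apply: measurableC;
    exact: measurable_stopped|exact: (measurable_total_pulls j.+1 (fun n =>
      (M < n)%N))].
rewrite ler_pdivlMr// -lee_fin; apply: le_trans hc.
rewrite EFinM fineK ?fin_num_measure// muleC.
rewrite -(setIT F) -integral_indic// -ge0_integralZl//; last first.
  by apply/measurable_EFinP; exact: measurable_indic.
apply: ge0_le_integral_nonmeasurable => w; first by rewrite mule_ge0// lee_fin.
rewrite -EFinM indicE; have [/set_mem[nsj MN]|_] := boolP (w \in F).
  by rewrite mulr1; apply: le_trans (nb_samples_ge w j nsj); rewrite lee_fin ler_nat.
by rewrite mulr0; exact: nb_samples_ge0.
Qed.

Lemma expected_batches_ge mu k :
  ((1 + k%:R * (1 - pr mu (stopped k)))%:E <= expected_batches alg P U X mu)%E.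
Proof.
have mS := measurable_stopped k.
have mSC : measurable (~` stopped k) by exact: measurableC.
have -> : 1 - pr mu (stopped k) = pr mu (~` stopped k).
  by rewrite probability_setC// fineB// fin_num_measure.
apply: (@le_trans _ _ (\int[P mu]_w (1 + (k%:R * \1_(~` stopped k) w)%:E))%E);
  last first.
  apply: ge0_le_integral_nonmeasurable => w; last exact: nb_batches_ge.
  by rewrite adde_ge0// lee_fin mulr_ge0.
rewrite ge0_integralD//; last first.
  by apply/measurable_EFinP; apply: measurable_funM => //; exact: measurable_indic.
have -> : (\int[P mu]_w 1 = 1 :> \bar R)%E.
  by rewrite integral_cst// mul1e; exact: probability_setT.
by rewrite integral_cst_indic// EFinD.
Qed.

End early_stopping.

(** * Union bound for the event of having stopped within [k] batches *)

Section stopping_bound.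
Context {R : realType} {K : nat} {sigma : R} {pb : problem R}.
Context {d : measure_display} {S : measurableType d}.
Variable alg : batched_algorithm R (answers K pb) S.
Context {d' : measure_display} {Omega : measurableType d'}.
Context {P : ('I_K -> R) -> probability Omega R}.
Context {U : Omega -> S} {X : 'I_K -> nat -> Omega -> R}.
Context (sigma0 : 0 < sigma) (model : gaussian_bandit sigma (seed_law alg) P U X).
Local Notation run := (run alg U X).
Local Notation N w r := (total_pulls (run w r)).
Local Notation stopped := (stopped alg (U := U) (X := X)).
Local Notation stops_first := (stops_first alg (U := U) (X := X)).
Local Notation truncated := (truncated alg (U := U) (X := X)).
Local Notation past := (past alg (U := U) (X := X)).
Local Notation pr m E := (fine (P m E)).

Let mstopped := measurable_stopped alg model.
Let mstops_first := measurable_stops_first alg model.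
Let mpulls := measurable_total_pulls alg model.

Lemma pr_le m (E F : set Omega) : measurable E -> measurable F -> E `<=` F ->
  pr m E <= pr m F.
Proof.
move=> mE mF EF; rewrite fine_le ?fin_num_measure//.
by apply: le_measure => //; rewrite inE.
Qed.

Lemma pr_setU m (E F : set Omega) : measurable E -> measurable F ->
  pr m (E `|` F) <= pr m E + pr m F.
Proof.
move=> mE mF; rewrite -lee_fin EFinD !fineK ?fin_num_measure//.
  exact: measureU2.
exact: measurableU.
Qed.

Lemma pr_bigsetU m (E : nat -> set Omega) k : (forall j, measurable (E j)) ->
  pr m (\big[setU/set0]_(j < k) E j) <= \sum_(j < k) pr m (E j).
Proof.
move=> mE; elim: k => [|k IH]; first by rewrite !big_ord0 measure0.
rewrite !big_ord_recr/=; apply: le_trans (pr_setU _ _ _ _ _) _ => //.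
  by apply: bigsetU_measurable.
by rewrite lerD2r.
Qed.

Definition overshoots j M M' : set Omega :=
  [set w | ~ stopped j w /\ ((N w j <= M)%N /\ (M' < N w j.+1)%N)].

Lemma measurable_overshoots j M M' : measurable (overshoots j M M').
Proof.
apply: (measurableI (~` stopped j)); first exact: measurableC.
apply: (measurableI [set w | (N w j <= M)%N]).
  exact: (mpulls j (fun n => (n <= M)%N)).
exact: (mpulls j.+1 (fun n => (M' < n)%N)).
Qed.

(** The event is decided by at most [M] samples, although it speaks of the total after batch [j.+1];
    so the Markov bound valid under [nu] is transported to [mu]. *)
Lemma overshoots_bound mu nu j M M' c t D x : 0 < t ->
  (forall i, `|mu i - nu i| <= D) -> M%:R * D ^+ 2 / sigma ^+ 2 <= x ->
  (expected_samples alg P U X nu <= c%:E)%E ->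
  pr mu (overshoots j M M') <= c / M'.+1%:R + (t + (expR x - 1) / t) / 2.
Proof.
move=> t0 hD hx hc.
apply: (le_trans (transport_truncated alg sigma0 model nu mu j M _ t D x t0 _ hD hx)).
  move=> r p rj; have [rj'|jr] := ltnP r j.
    (* On a cell with [r < j] the budget [M] is exceeded after batch [r.+1] already, which
       contradicts [N w j <= M]. *)
    exists set0; first exact: past0.
    rewrite set0I; apply/seteqP; split=> // w [[_ [h _]] [_ _ /(_ rj')]].
    by rewrite ltnNge (leq_trans _ h)// total_pulls_mono.
  have <- : r = j by apply/eqP; rewrite eqn_leq rj.
  exists (~` stopped r `&` [set w | (M' < \sum_i p i +
     \sum_i batch_size alg (U w) (run w r) i)%N]).
    apply: pastI; first by apply: pastC; exact: past_stopped.
    exact: (past_batch_size alg r p (fun b => (M' < \sum_i p i + \sum_i b i)%N)).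
  have NE w : (forall i, pulls (run w r) i = p i) -> N w r = (\sum_i p i)%N.
    by move=> hp; apply: eq_bigr => i _; exact: hp.
  apply/seteqP; split=> w [h tr]; split=> //; case: h; case: tr => hp h1 h2.
    by move=> ns [_]; rewrite total_pulls_S NE.
  by move=> ns h; split=> //; split=> //; rewrite total_pulls_S NE.
rewrite lerD2r; apply: le_trans _ (markov_samples alg model nu j M' c hc).
apply: pr_le.
- exact: measurable_overshoots.
- apply: (measurableI (~` stopped j)); first exact: measurableC.
  exact: (mpulls j.+1 (fun n => (M' < n)%N)).
- by move=> w [? [_ ?]].
Qed.

Definition answers_within k M A : set Omega :=
  [set w | exists2 r, (r <= k)%N & stops_first r (Some A) w /\ (N w r <= M)%N].

Lemma measurable_answers_within k M A : measurable (answers_within k M A).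
Proof.
rewrite (_ : answers_within k M A = \bigcup_r (stops_first r (Some A) `&`
    [set w | (r <= k)%N && (N w r <= M)%N])); last first.
  apply/seteqP; split=> [w [r rk [? NM]]|w [r _ [? /andP[rk NM]]]]; exists r => //.
  by split=> //; apply/andP.
apply: bigcupT_measurable => r; apply: measurableI => //.
exact: (mpulls r (fun n => (r <= k)%N && (n <= M)%N)).
Qed.

(** On a cell ending at batch [r], a stop at a later batch among the first [k] would use more than
    [M] samples; so the event amounts there to a first stop at some batch up to [r], with answer
    [A]. *)
Lemma answers_within_transport mu mu' k M A t D x : 0 < t ->
  (forall i, `|mu i - mu' i| <= D) -> M%:R * D ^+ 2 / sigma ^+ 2 <= x ->
  pr mu (answers_within k M A) <=
  pr mu' (answers_within k M A) + (t + (expR x - 1) / t) / 2.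
Proof.
move=> t0 hD hx; apply: (transport_truncated alg sigma0 model mu' mu k M _ t D x t0
  _ hD hx).
move=> r p rk.
exists (\bigcup_r' ([set _ | (r' <= r)%N] `&` stops_first r' (Some A))).
  apply: past_bigcup => r'; have [rr'|rr'] := leqP r' r.
    by apply: pastI; [exact: past_cst|exact: past_stops_first].
  by rewrite (_ : _ `&` _ = set0); [exact: past0|apply/seteqP; split=> // w []].
apply/seteqP; split=> w [h [hp NM Nr]].
  split=> //; case: h => r' r'k [sf Nr'M]; exists r' => //; split=> //=.
  rewrite leqNgt; apply/negP => rr'.
  have := Nr (leq_trans rr' r'k); rewrite ltnNge => /negP; apply.
  exact: leq_trans (total_pulls_mono alg w _ _ rr') Nr'M.
split=> //; case: h => r' _ [/= rr' sf]; exists r'; first exact: leq_trans rk.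
split=> //; exact: leq_trans (total_pulls_mono alg w _ _ rr') NM.
Qed.

Definition answers_wrongly mu : set Omega :=
  [set omega | exists2 A, returned_answer alg U X omega = Some A &
                          A != correct_answer pb mu].

Lemma measurable_answers_wrongly mu : measurable (answers_wrongly mu).
Proof.
rewrite (_ : answers_wrongly mu = \bigcup_(rA : nat * {set 'I_K})
   (stops_first rA.1 (Some rA.2) `&` [set _ | rA.2 != correct_answer pb mu])).
  apply: countable_bigcupT_measurable; first exact: countableP.
  move=> [r A]; apply: measurableI => //=.
  have [AC|AC] := boolP (A != correct_answer pb mu).
    by rewrite (_ : [set _ | _] = setT)//; apply/seteqP; split.
  by rewrite (_ : [set _ | _] = set0)//; apply/seteqP; split.
apply/seteqP; split=> [w [A /returned_answerP[r sf] AC]|w [[r A] _ [sf AC]]].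
  by exists (r, A).
by exists A => //; apply/returned_answerP; exists r.
Qed.

Lemma pr_wrong_le delta C mu : delta_correct alg P U X delta C -> C mu ->
  pr mu (answers_wrongly mu) <= delta.
Proof.
move=> hC Cmu; rewrite -lee_fin fineK ?fin_num_measure//; first exact: hC.
exact: measurable_answers_wrongly.
Qed.

Lemma answers_within_wrong mu' k M A : A != correct_answer pb mu' ->
  answers_within k M A `<=` answers_wrongly mu'.
Proof.
by move=> AC w [r _ [sf _]]; exists A => //; apply/returned_answerP; exists r.
Qed.

(** If the answer is correct but came after more than [M k] samples, take the least [j] with
    [M j < N w j]. It is positive because both sides vanish at 0, so by minimality batch [j]
    overshoots. *)
Lemma stopped_subset mu k (M : nat -> nat) : M 0%N = 0%N ->
  {homo M : m n / (m <= n)%N} ->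
  stopped k `<=` answers_wrongly mu `|` answers_within k (M k) (correct_answer pb mu)
    `|` \big[setU/set0]_(j < k) overshoots j (M j) (M j.+1).
Proof.
move=> M0 Mhomo w [r0 r0k sr0].
have [[r [_ sf]]|[_ /(_ r0)]] := stopping_batchP alg w (X := X) (U := U);
  last by rewrite sr0.
have rk : (r <= k)%N.
  apply: leq_trans r0k; rewrite leqNgt; apply/negP => h.
  by case: sf => -[_ /(_ _ h)]; rewrite sr0.
move: sf; case E : (decision alg (U w) (run w r)) => [A|] sf; last first.
  by case: sf => -[]; rewrite /stops E andbF.
have [AC|AC] := eqVneq A (correct_answer pb mu); last first.
  by left; left; exists A => //; apply/returned_answerP; exists r.
have [NM|MN] := leqP (N w r) (M k).
  by left; right; rewrite -AC; exists r.
right; rewrite -(bigcup_mkord k (fun j => overshoots j (M j) (M j.+1))).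
have [j /andP[jr MNj] jmin] : exists2 j, (j <= r)%N && (M j < N w j)%N &
    forall i, (i < j)%N -> (N w i <= M i)%N.
  have ex : exists j, (j <= r)%N && (M j < N w j)%N.
    (* The stopping batch qualifies: [M r <= M k < N w r]. *)
    by exists r; rewrite leqnn (leq_ltn_trans _ MN)// Mhomo.
  case: (ex_minnP ex) => j hj jmin; exists j => // i ij; rewrite leqNgt.
  apply/negP => h; have : (j <= i)%N.
    by apply: jmin; rewrite h andbT; case/andP: hj => jr _;
      exact: leq_trans (ltnW ij) jr.
  by rewrite leqNgt ij.
case: j jr MNj jmin => [|j] jr MNj jmin.
  by move: MNj; rewrite total_pulls0.
exists j; first by rewrite /= (leq_trans jr).
split; last by split=> //; exact: jmin.
move=> [r' r'j sr']; case: sf => -[_ /(_ r')] + _.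
by rewrite sr' (leq_ltn_trans r'j jr) => /(_ isT).
Qed.

(** One [delta] is the error probability under [mu]. The other is the error probability under [mu'],
    for which the correct answer of [mu] is an error, transported at scale [t']; the sum accounts
    for the overshoots. *)
Lemma pr_stopped_le mu mu' k (M : nat -> nat) (nu : nat -> 'I_K -> R)
    (c D : nat -> R) delta C t t' D' x x' :
  0 < t -> 0 < t' ->
  M 0%N = 0%N -> {homo M : m n / (m <= n)%N} ->
  (forall j, (j < k)%N -> (expected_samples alg P U X (nu j) <= (c j)%:E)%E) ->
  (forall j, (j < k)%N -> forall i, `|mu i - nu j i| <= D j) ->
  (forall j, (j < k)%N -> (M j)%:R * D j ^+ 2 / sigma ^+ 2 <= x) ->
  (forall i, `|mu i - mu' i| <= D') -> (M k)%:R * D' ^+ 2 / sigma ^+ 2 <= x' ->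
  delta_correct alg P U X delta C -> C mu -> C mu' ->
  correct_answer pb mu != correct_answer pb mu' ->
  pr mu (stopped k) <= delta + (delta + (t' + (expR x' - 1) / t') / 2) +
    \sum_(j < k) (c j / (M j.+1).+1%:R + (t + (expR x - 1) / t) / 2).
Proof.
move=> t0 t'0 M0 Mhomo hc hD hx hD' hx' hdelta Cmu Cmu' neq.
have mW := measurable_answers_wrongly.
have mA := measurable_answers_within.
have mO := measurable_overshoots.
have mbig : measurable (\big[setU/set0]_(j < k) overshoots j (M j) (M j.+1)).
  by apply: bigsetU_measurable.
apply: (le_trans (pr_le mu _ _ _ _ (stopped_subset mu k M M0 Mhomo))) => //.
  by apply: measurableU => //; exact: measurableU.
apply: (le_trans (pr_setU mu _ _ _ _)) => //; first exact: measurableU.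
apply: lerD.
  apply: (le_trans (pr_setU mu _ _ _ _)) => //; apply: lerD.
    exact: pr_wrong_le hdelta Cmu.
  apply: (le_trans (answers_within_transport mu mu' k _ _ t' D' x' t'0 hD' hx')).
  rewrite lerD2r; apply: le_trans (pr_wrong_le delta C mu' hdelta Cmu').
  by apply: pr_le => //; exact: answers_within_wrong.
apply: (le_trans (pr_bigsetU mu (fun j => overshoots j (M j) (M j.+1)) k _)) => //.
apply: ler_sum => j _.
by apply: (overshoots_bound mu (nu j) j _ _ (c j) t (D j) x) => //;
  [exact: hD|exact: hx|exact: hc].
Qed.

End stopping_bound.

(** * Complexity of dilated and permuted instances *)

Section complexity_transform.
Context {R : realType} {K : nat}.
Implicit Types (pb : problem R) (mu lambda w : 'I_K -> R) (pi : 'S_K).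

(** One family for all the instances needed: homotheties for [s > 0], the reflection through [c] for
    [s = -1], permutations of the arms for [s = 1]. *)
Definition dilate (c s : R) pi mu : 'I_K -> R := fun i => c + s * (mu (pi i) - c).

Lemma dilateVK c s pi mu : s != 0 -> dilate c s pi (dilate c s^-1 pi^-1%g mu) = mu.
Proof. by move=> s0; apply/funext => i; rewrite /dilate permK; field. Qed.

Lemma simplex_perm pi w : simplex w -> simplex (fun i => w (pi i)).
Proof.
by case=> w0 w1; split=> //; rewrite -w1 [RHS](reindex_inj (@perm_inj _ pi)).
Qed.

(** Dilating both instances multiplies the cost by s^2 and permutes the weights; the simplex is
    stable under permutations, and the alternatives correspond by hypothesis. *)
Lemma inv_complexity_dilate pb (sigma c s : R) pi mu : s != 0 ->
  (forall lambda, Alt pb mu lambda <-> Alt pb (dilate c s pi mu) (dilate c s pi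
    lambda)) ->
  (inv_complexity pb sigma (dilate c s pi mu) =
   (s ^+ 2)%:E * inv_complexity pb sigma mu)%E.
Proof.
move=> s0 hAlt; have s20 : 0 < s ^+ 2 by rewrite exprn_even_gt0.
rewrite /inv_complexity -ereal_sup_pZl//.
pose cost m w lambda : \bar R :=
  (\sum_i w i * ((m i - lambda i) ^+ 2 / (2 * sigma ^+ 2)))%:E.
have costE w lambda : cost (dilate c s pi mu) w (dilate c s pi lambda) =
    ((s ^+ 2)%:E * cost mu (fun i => w (pi^-1 i)%g) lambda)%E.
  rewrite /cost -EFinM; congr _%:E; rewrite mulr_sumr.
  rewrite [RHS](reindex_inj (@perm_inj _ pi)); apply: eq_bigr => i _.
  rewrite permK /dilate; ring.
have infE w : ereal_inf [set cost (dilate c s pi mu) w l | l in Alt pb (dilate c s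
  pi mu)] =
    ((s ^+ 2)%:E * ereal_inf [set cost mu (fun i =>
      w (pi^-1 i)%g) l | l in Alt pb mu])%E.
  rewrite -ereal_inf_pZl//; congr ereal_inf; apply/seteqP; split => z /=.
    move=> [l hl <-]; exists (cost mu (fun i =>
      w (pi^-1 i)%g) (dilate c s^-1 pi^-1%g l)).
      exists (dilate c s^-1 pi^-1%g l) => //.
      by have h := hAlt (dilate c s^-1 pi^-1%g l); rewrite dilateVK// in h; exact: h.2.
    by rewrite -costE dilateVK.
  by move=> [_ [l hl <-] <-]; exists (dilate c s pi l);
    [exact: (hAlt _).1|exact: costE].
congr ereal_sup; apply/seteqP; split => z /=.
  move=> [w hw <-]; exists (ereal_inf [set cost mu (fun i =>
    w (pi^-1 i)%g) l | l in Alt pb mu]).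
    by exists (fun i => w (pi^-1 i)%g) => //; exact: simplex_perm.
  by rewrite -infE.
move=> [_ [w hw <-] <-]; exists (fun i => w (pi i)); first exact: simplex_perm.
apply: etrans (infE _) _; congr (_ * ereal_inf _)%E.
by congr image; apply/funext => l; rewrite /cost; congr _%:E; apply: eq_bigr => i _;
  rewrite permKV.
Qed.

(** An increasing affine map commutes with sorting, and permuting the arms leaves the sorted list
    unchanged. *)
Lemma kth_largest_dilate (c s : R) pi mu k : 0 < s -> (1 <= k)%N -> (k <= K)%N ->
  kth_largest (dilate c s pi mu) k = c + s * (kth_largest mu k - c).
Proof.
move=> s0 k1 kK; pose f x := c + s * (x - c).
have geT : total (fun x y : R => y <= x) by move=> x y; exact: le_total.
have geTr : transitive (fun x y : R => y <= x) by move=> y x z /= h1 h2;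
  exact: le_trans h2 h1.
have geA : antisymmetric (fun x y : R => y <= x) by move=> x y; rewrite andbC;
  exact: le_anti.
rewrite /kth_largest.
have -> : sort (fun x y : R => y <= x) (codom (dilate c s pi mu)) =
    [seq f x | x <- sort (fun x y : R => y <= x) (codom mu)].
  have <- : sort (relpre f (fun x y : R => y <= x)) (codom (fun i => mu (pi i))) =
      sort (fun x y : R => y <= x) (codom mu).
    have -> : rel_of_simpl (relpre f (fun x y : R => y <= x)) = (fun x y : R => y <= x).
      by apply/funext => x; apply/funext => y; rewrite /= /f lerD2l ler_pM2l// lerD2r.
    apply/(perm_sortP geT geTr geA); rewrite /codom /image_mem.
    rewrite (map_comp mu pi); apply: perm_map.
    apply: uniq_perm; rewrite ?(map_inj_uniq perm_inj) ?enum_uniq// => i.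
    rewrite mem_enum; apply/mapP; exists (pi^-1 i)%g; rewrite ?mem_enum//.
    by rewrite permKV.
  by rewrite -sort_map /codom /image_mem -[in RHS]map_comp; congr sort; apply: eq_map.
rewrite (nth_map 0)// size_sort size_codom card_ord.
by case: k k1 kK.
Qed.

Lemma mem_correct_dilate (c s : R) pi k mu i : 0 < s -> (1 <= k)%N -> (k <= K)%N ->
  (i \in correct_answer (TopK k) (dilate c s pi mu)) =
    (pi i \in correct_answer (TopK k) mu).
Proof.
move=> s0 k1 kK; rewrite !inE kth_largest_dilate// /dilate.
by rewrite lerD2l ler_pM2l// lerD2r.
Qed.

Lemma well_defined_dilate (c s : R) pi k mu : 0 < s -> (1 <= k)%N -> (k < K)%N ->
  well_defined (TopK k) (dilate c s pi mu) <-> well_defined (TopK k) mu.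
Proof.
move=> s0 k1 kK; rewrite /= !kth_largest_dilate//; last exact: ltnW.
by rewrite ltrD2l ltr_pM2l// ltrD2r.
Qed.

Lemma Alt_dilate (c s : R) pi k mu lambda : 0 < s -> (1 <= k)%N -> (k < K)%N ->
  Alt (TopK k) mu lambda <-> Alt (TopK k) (dilate c s pi mu) (dilate c s pi lambda).
Proof.
move=> s0 k1 kK.
have wd := well_defined_dilate c s pi k lambda s0 k1 kK.
have mem m i := mem_correct_dilate c s pi k m i s0 k1 (ltnW kK).
split=> -[hl /eqP neq]; (split; first exact/wd); apply/eqP => E; apply: neq.
  apply/setP => i; have /setP/(_ (pi^-1 i)%g) := E.
  by rewrite !mem permKV.
by apply/setP => i; rewrite !mem E.
Qed.

Lemma dilate1 (c s : R) mu i : dilate c s 1%g mu i = c + s * (mu i - c).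
Proof. by rewrite /dilate perm1. Qed.

Lemma well_defined_dilate_thresholding (tau s : R) mu : s != 0 ->
  well_defined (Thresholding tau) (dilate tau s 1%g mu) <->
  well_defined (Thresholding tau) mu.
Proof.
move=> s0; have E i : (dilate tau s 1%g mu i != tau) = (mu i != tau).
  rewrite dilate1 -subr_eq0 addrAC subrr add0r mulf_eq0 (negbTE s0)/=.
  by rewrite subr_eq0.
by split=> h i; have := h i; rewrite /= E.
Qed.

Lemma correct_dilate_thresholding (tau s : R) mu : 0 < s ->
  correct_answer (Thresholding tau) (dilate tau s 1%g mu) =
  correct_answer (Thresholding tau) mu.
Proof.
move=> s0; apply/setP => i; rewrite !inE dilate1.
by rewrite -subr_gt0 addrAC subrr add0r pmulr_rgt0// subr_gt0.
Qed.

Lemma correct_reflect_thresholding (tau : R) mu : well_defined (Thresholding tau) mu ->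
  correct_answer (Thresholding tau) (dilate tau (-1) 1%g mu) =
  ~: correct_answer (Thresholding tau) mu.
Proof.
move=> h; apply/setP => i; rewrite !inE dilate1.
rewrite -subr_gt0 addrAC subrr add0r mulN1r opprB subr_gt0 -leNgt.
by rewrite lt_neqAle (h i).
Qed.

Lemma Alt_dilate_thresholding (tau s : R) mu lambda : 0 < s ->
  Alt (Thresholding tau) mu lambda <->
  Alt (Thresholding tau) (dilate tau s 1%g mu) (dilate tau s 1%g lambda).
Proof.
move=> s0; have wd := well_defined_dilate_thresholding tau s lambda (lt0r_neq0 s0).
split=> -[hl neq]; (split; first exact/wd); move: neq.
  by rewrite !correct_dilate_thresholding.
by rewrite !correct_dilate_thresholding.
Qed.

Lemma Alt_reflect_thresholding (tau : R) mu lambda : well_defined (Thresholding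
  tau) mu ->
  Alt (Thresholding tau) mu lambda <->
  Alt (Thresholding tau) (dilate tau (-1) 1%g mu) (dilate tau (-1) 1%g lambda).
Proof.
move=> hm.
have N1 : -1 != 0 :> R by rewrite oppr_eq0 oner_eq0.
have wd := well_defined_dilate_thresholding tau (-1) lambda N1.
split=> -[hl neq].
  split; first exact/wd.
  by rewrite !correct_reflect_thresholding// (inj_eq (@finset.setC_inj _)).
have hl' := (wd.1 hl); split=> //; move: neq.
by rewrite !correct_reflect_thresholding// (inj_eq (@finset.setC_inj _)).
Qed.

End complexity_transform.

(** * Instances of prescribed complexity near a given one *)

Section instance_families.
Context {R : realType} {K : nat}.
Implicit Types (pb : problem R) (mu : 'I_K -> R).

Lemma instances_Tstar pb (sigma Tmin Tmax : R) mu : 0 < Tmin ->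
  instances pb sigma Tmin Tmax mu ->
  [/\ complexity pb sigma mu = (Tstar pb sigma mu)%:E,
      Tmin < Tstar pb sigma mu < Tmax &
      inv_complexity pb sigma mu = ((Tstar pb sigma mu)^-1)%:E].
Proof.
move=> Tmin0 [_ /andP[h1 h2]].
have fin : complexity pb sigma mu \is a fin_num.
  by rewrite fin_numE gt_eqF ?(lt_trans _ h1) ?ltNyr//= lt_eqF ?(lt_trans h2) ?ltry.
have E : complexity pb sigma mu = (Tstar pb sigma mu)%:E by rewrite /Tstar fineK.
rewrite E !lte_fin in h1 h2; split=> //; first by rewrite h1.
have T0 : 0 < Tstar pb sigma mu by exact: lt_trans h1.
(* The inverse complexities 0, [+oo] and [-oo] invert to [+oo], 0 and [-oo], none of which is a
   positive real. *)
move: E; rewrite /complexity; case: (inv_complexity pb sigma mu) => [v| |].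
- have [->|v0] := eqVneq v 0; first by rewrite inve0.
  by rewrite inver (negbTE v0) => -[<-]; rewrite invrK.
- by rewrite invey => -[E]; move: T0; rewrite -E ltxx.
- by rewrite inveNy.
Qed.

Lemma complexity_dilate pb (sigma c s T : R) pi mu : 0 < T -> s != 0 ->
  inv_complexity pb sigma mu = (T^-1)%:E ->
  (forall lambda, Alt pb mu lambda <-> Alt pb (dilate c s pi mu) (dilate c s pi
    lambda)) ->
  complexity pb sigma (dilate c s pi mu) = (T / s ^+ 2)%:E.
Proof.
move=> T0 s0 hT hAlt; rewrite /complexity inv_complexity_dilate// hT -EFinM inver.
rewrite mulf_eq0 expf_eq0 (negbTE s0) andbF invr_eq0 (gt_eqF T0)/=.
by rewrite invfM invrK mulrC.
Qed.

Lemma has_ubound_range mu : has_ubound (range mu).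
Proof.
exists (\sum_i `|mu i|) => _ [i _ <-]; rewrite (bigD1 i)//=.
by rewrite (le_trans (ler_norm _))// lerDl sumr_ge0.
Qed.

Lemma has_lbound_range mu : has_lbound (range mu).
Proof.
exists (- \sum_i `|mu i|) => _ [i _ <-]; rewrite (bigD1 i)//=.
rewrite lerNl (le_trans (ler_norm _))// normrN lerDl.
by rewrite sumr_ge0.
Qed.

Definition center pb mu : R :=
  match pb with
  | TopK _ => (sup (range mu) + inf (range mu)) / 2
  | Thresholding tau => tau
  end.

Lemma dist_center pb mu i : `|mu i - center pb mu| <= Delta pb mu.
Proof.
case: pb => [k|tau] /=; last exact: le_bigmax.
have h1 : mu i <= sup (range mu) by apply: ub_le_sup;
  [exact: has_ubound_range|exists i].
have h2 : inf (range mu) <= mu i by apply: ge_inf; [exact: has_lbound_range|exists i].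
by rewrite ler_norml; apply/andP; split; lra.
Qed.

Lemma dilate_instance pb (sigma s T : R) mu : valid_problem K pb ->
  well_defined pb mu -> 0 < T -> inv_complexity pb sigma mu = (T^-1)%:E -> 0 < s ->
  well_defined pb (dilate (center pb mu) s 1%g mu) /\
  complexity pb sigma (dilate (center pb mu) s 1%g mu) = (T / s ^+ 2)%:E.
Proof.
move=> vpb wd T0 hT s0; have sn0 := lt0r_neq0 s0.
case: pb vpb wd hT => [k [k1 kK]|tau _] wd hT.
  split; first exact/well_defined_dilate.
  by apply: complexity_dilate => // lambda; exact: Alt_dilate.
split; first exact/well_defined_dilate_thresholding.
by apply: complexity_dilate => // lambda; exact: Alt_dilate_thresholding.
Qed.

Lemma kth_largest_in_codom mu k : (1 <= k)%N -> (k <= K)%N ->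
  exists i, mu i = kth_largest mu k.
Proof.
move=> k1 kK; have : kth_largest mu k \in codom mu.
  rewrite -(mem_sort (fun x y : R => y <= x)) mem_nth// size_sort size_codom card_ord.
  by case: k k1 kK.
by move=> /codomP[i ->]; exists i.
Qed.

(** Exchange the arms of ranks k and k + 1, or reflect through the threshold. Both are dilations
    with s^2 = 1, so the complexity is kept, and old and new means lie within [Delta] of the
    center. *)
Lemma confusing_instance pb (sigma T : R) mu : valid_problem K pb ->
  well_defined pb mu -> 0 < T -> inv_complexity pb sigma mu = (T^-1)%:E ->
  exists mu', [/\ well_defined pb mu', complexity pb sigma mu' = T%:E,
    correct_answer pb mu != correct_answer pb mu' &
    forall i, `|mu i - mu' i| <= 2 * Delta pb mu].
Proof.
move=> vpb wd T0 hT.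
have hD i := dist_center pb mu i.
case: pb vpb wd hT hD => [k [k1 kK]|tau _] wd hT hD.
  have [i0 i0E] := kth_largest_in_codom mu k k1 (ltnW kK).
  have [j0 j0E] := kth_largest_in_codom mu k.+1 isT kK.
  exists (dilate 0 1 (tperm i0 j0) mu); split.
  - exact/well_defined_dilate.
  - rewrite (complexity_dilate _ _ _ _ T)//; first by rewrite expr1n divr1.
    by move=> lambda; exact: Alt_dilate.
  - apply/eqP => /setP/(_ i0).
    rewrite (mem_correct_dilate 0 1 (tperm i0 j0) k mu)//; last exact: ltnW.
    by rewrite tpermL !inE i0E lexx j0E leNgt wd.
  - move=> i; rewrite /dilate add0r subr0 mul1r.
    have := hD i; have := hD (tperm i0 j0 i); rewrite !ler_norml.
    by move=> /andP[? ?] /andP[? ?]; apply/andP; split; lra.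
have N1 : -1 != 0 :> R by rewrite oppr_eq0 oner_eq0.
exists (dilate tau (-1) 1%g mu); split.
- exact/well_defined_dilate_thresholding.
- rewrite (complexity_dilate _ _ _ _ T)//; first by rewrite sqrrN expr1n divr1.
  by move=> lambda; exact: Alt_reflect_thresholding.
- rewrite correct_reflect_thresholding//; apply/eqP => E.
  have [i _|K0] := pickP (fun _ : 'I_K => true).
    by move/setP/(_ i) : E; rewrite [in RHS]inE; case: (_ \in _).
  (* Without arms the reflection changes nothing, but then the supremum over the empty simplex is
     [-oo], not [T^-1]. *)
  suff : simplex (R := R) (K := K) = set0.
    move=> s0; move: hT; rewrite /inv_complexity s0 image_set0 ereal_sup0.
    by [].
  apply/seteqP; split=> // w [_]; rewrite big1 => [/esym/eqP|i _].
    by rewrite oner_eq0.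
  by have := K0 i.
- move=> i; rewrite dilate1; have := hD i; rewrite /= !ler_norml.
  by move=> /andP[? ?]; apply/andP; split; lra.
Qed.

End instance_families.

(** * Numerical estimates *)

Section numerics.
Context {R : realType}.
Implicit Types x L V : R.

(** From e^x (1 - x) <= 1 one gets e^x - 1 <= x e^x and e^x <= 36/35. The range is that of t^2 for t
    <= 1/6. *)
Lemma expR_sub1_le x : 0 <= x <= 36^-1 -> expR x - 1 <= 36 / 35 * x.
Proof.
move=> /andP[x0 x36]; have h := expR_ge1Dx (- x).
have ex : expR x * expR (- x) = 1 by rewrite -expRD subrr expR0.
have e0 := expR_gt0 x.
have h2 : expR x * (1 - x) <= 1 by rewrite -[leRHS]ex ler_wpM2l// ltW.
have h3 : expR x * x <= expR x * 36^-1 by rewrite ler_wpM2l// ltW.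
have h4 : expR x <= 36 / 35 by lra.
have h5 : expR x * x <= 36 / 35 * x by rewrite ler_wpM2r.
lra.
Qed.

(** The choice x = t^2 makes both terms about [t]; 71/70 is the mean of 1 and 36/35. *)
Lemma transport_cost_le L t x : 6 <= L -> 0 < t -> t <= L^-1 -> x = t ^+ 2 ->
  (t + (expR x - 1) / t) / 2 <= 71 / 70 * t.
Proof.
move=> L6 t0 tL ->; have L0 : 0 < L by lra.
have t6 : t <= 6^-1 by rewrite (le_trans tL)// lef_pV2 ?posrE.
have h : expR (t ^+ 2) - 1 <= 36 / 35 * t ^+ 2.
  by apply: expR_sub1_le; apply/andP; split; nra.
have : (expR (t ^+ 2) - 1) / t <= 36 / 35 * t.
  by rewrite ler_pdivrMr//; lra.
lra.
Qed.

(* Here x = L / lam, the algorithm has stopped within k batches with probability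
   p, and V is the lower bound to be proved. *)
Lemma rounds_le (V L delta lam x k p : R) : 1 < V -> V <= x / 2 -> V <= L / 6 ->
  V * (6 * delta) <= 1 -> k < x -> x <= k + 1 -> x * lam = L -> 4 <= lam ->
  p <= 2 * delta + 71 / 70 * L^-1 + k * (L^-1 + 71 / 70 * (2 * L)^-1) ->
  V <= 1 + k * (1 - p).
Proof.
move=> V1 Vx VL Vd kx xk xl l4 hp.
have L0 : 0 < L by lra.
set u := L^-1 in hp.
have uL : u * L = 1 by rewrite mulVf// gt_eqF.
have u0 : 0 < u by rewrite invr_gt0.
have u2 : (2 * L)^-1 = u / 2 by rewrite invfM mulrC.
rewrite u2 in hp.
have uV : u * V <= 6^-1 by nra.
have k1 : 1 <= k by lra.
have ku : k * u <= 4^-1 by nra.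
(* The terms come from 6 delta V <= 1, V / L <= 1/6 and k / L <= 1/4, with 211/560 = (1 + 71/140) /
   4. *)
have pV : p * V <= 3^-1 + 71 / 420 + 211 / 560 * V.
  have h1 : p * V <= (2 * delta + 71 / 70 * u + k * (u + 71 / 70 * (u / 2))) * V.
    by rewrite ler_wpM2r//; lra.
  have h2 : (k * u) * V <= 4^-1 * V by rewrite ler_wpM2r//; lra.
  nra.
have V0 : 0 < V by lra.
rewrite -(ler_pM2r V0).
(* This uses 2 V <= x <= k + 1. *)
have h3 : (2 * V - 1) * ((1 - p) * V) <= k * ((1 - p) * V).
  by rewrite ler_wpM2r//; nra.
have h4 : (2 * V - 1) * (V - (3^-1 + 71 / 420 + 211 / 560 * V)) <=
    (2 * V - 1) * ((1 - p) * V).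
  by rewrite ler_wpM2l//; lra.
(* There remains a quadratic in [V] of negative discriminant, whose minimum is attained near
   51/40. *)
have h5 := sqr_ge0 (V - 51 / 40).
lra.
Qed.

(* Gives ln rho >= 4, since rho >= L^2 e >= 36 e. *)
Lemma expR3_le : expR 3 <= 36 :> R.
Proof.
have h := @expR_ge1Dx R (- 6^-1).
have e0 := expR_gt0 (6^-1 : R).
have ex : expR 6^-1 * expR (- 6^-1) = 1 :> R by rewrite -expRD subrr expR0.
have h2 : expR 6^-1 <= 6 / 5 :> R by nra.
(* e^3 is the 18th power of e^(1/6) <= 6/5, and (6/5)^18 is below 27. *)
have -> : 3 = 18%:R * 6^-1 :> R by field.
rewrite expRM_natl; apply: (@le_trans _ _ ((6 / 5) ^+ 18)).
  by rewrite lerXn2r// nnegrE ltW.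
by rewrite !exprS expr0; lra.
Qed.

End numerics.

(** * The lower bound *)

Section batch_complexity.
Context {R : realType} {K : nat} {sigma : R} {pb : problem R}.
Context {d : measure_display} {S : measurableType d}.
Variable alg : batched_algorithm R (answers K pb) S.
Context {d' : measure_display} {Omega : measurableType d'}.
Context {P : ('I_K -> R) -> probability Omega R}.
Context {U : Omega -> S} {X : 'I_K -> nat -> Omega -> R}.
Context (sigma0 : 0 < sigma) (model : gaussian_bandit sigma (seed_law alg) P U X).

Lemma expected_batches_ge1 mu : (1 <= expected_batches alg P U X mu)%E.
Proof.
by have := expected_batches_ge alg model mu 0; rewrite mul0r addr0.
Qed.

(** The strict side keeps the complexities of the dilated instances above [Tmin]; the other side
    gives k >= x - 1. *)
Lemma last_nat_below (x : R) : 0 < x -> exists k : nat, k%:R < x <= k.+1%:R.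
Proof.
move=> x0; have ex : exists n : nat, x <= n%:R.
  by exists (Num.truncn x).+1; rewrite ltW// truncnS_gt.
case: (ex_minnP ex) => -[|k] xk kmin; first by move: xk; rewrite leNgt x0.
exists k; rewrite xk andbT ltNge; apply/negP => /kmin.
by rewrite ltnn.
Qed.

(** The case of finite [gamma], over the reals: [G] stands for gamma ln(1/delta), and [rho] is any
    number with the two properties required of L^2 max{e, C_delta}. *)
Lemma expected_batches_lower_bound (delta Tmin Tmax G rho V : R) mu :
  let T := Tstar pb sigma mu in
  let L := ln (T / Tmin) in
  let Del := Delta pb mu in
  valid_problem K pb -> 0 < delta -> 0 < Tmin ->
  delta_correct alg P U X delta (instances pb sigma Tmin Tmax) ->
  instances pb sigma Tmin Tmax mu ->
  0 <= G ->
  (forall nu T', instances pb sigma Tmin Tmax nu -> complexity pb sigma nu = T'%:E ->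
     (expected_samples alg P U X nu <= (G * T')%:E)%E) ->
  6 <= L -> 4 <= ln rho -> 0 < rho ->
  4 * G * L ^+ 3 * (T * Del ^+ 2 / sigma ^+ 2) <= rho ->
  1 < V -> V <= L / ln rho / 2 -> V <= L / 6 -> V * (6 * delta) <= 1 ->
  (V%:E <= expected_batches alg P U X mu)%E.
Proof.
move=> T L Del vpb delta0 Tmin0 hdelta hmu G0 hG L6 lr4 rho0 hrho V1 Vx VL Vd.
have [compT /andP[TminT TTmax] invT] := instances_Tstar pb sigma Tmin Tmax mu Tmin0 hmu.
rewrite -/T in compT TminT TTmax invT.
have T0 : 0 < T by exact: lt_trans TminT.
have L0 : 0 < L by lra.
have lr0 : 0 < ln rho by lra.
have rho1 : 1 < rho by rewrite -ltr_ln ?posrE// ln1.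
have [k /andP[kx xk]] : exists k : nat, k%:R < L / ln rho <= k.+1%:R.
  by apply: last_nat_below; rewrite divr_gt0.
have k0 : (0 < k)%N.
  rewrite lt0n; apply/eqP => k0; rewrite k0 in xk; lra.
have rhok j : (j <= k)%N -> rho ^+ j < T / Tmin.
  move=> jk; rewrite -ltr_ln ?posrE ?exprn_gt0 ?divr_gt0// -/L.
  rewrite lnXn// -mulr_natl; apply: (@le_lt_trans _ _ (k%:R * ln rho)).
    by rewrite ler_pM2r// ler_nat.
  by rewrite -ltr_pdivlMr.
pose s j := Num.sqrt (rho ^+ (k - j)).
have s0 j : 0 < s j by rewrite sqrtr_gt0 exprn_gt0.
have s2 j : s j ^+ 2 = rho ^+ (k - j) by rewrite sqr_sqrtr// exprn_ge0// ltW.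
have s1 j : 1 <= s j.
  rewrite -[leLHS]sqrtr1 ler_sqrt; first exact/exprn_ege1/ltW.
  by rewrite exprn_ge0// ltW.
pose nu j := dilate (center pb mu) (s j) 1%g mu.
pose Tj j := T / rho ^+ (k - j).
have wd : well_defined pb mu by case: hmu.
have nuE j := dilate_instance pb sigma (s j) T mu vpb wd T0 invT (s0 j).
have nuI j : instances pb sigma Tmin Tmax (nu j).
  split; first exact: (nuE j).1.
  rewrite (nuE j).2 s2 !lte_fin; apply/andP; split.
    have := rhok (k - j)%N (leq_subr _ _).
    by rewrite !ltr_pdivlMr ?exprn_gt0// mulrC.
  apply: le_lt_trans TTmax; rewrite ler_pdivrMr ?exprn_gt0//.
  by rewrite ler_pMr// exprn_ege1// ltW.
have Tj0 j : 0 < Tj j by rewrite divr_gt0// exprn_gt0.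
have Tjmono : {homo Tj : m n / (m <= n)%N >-> m <= n}.
  move=> m n mn; rewrite ler_wpM2l ?(ltW T0)// lef_pV2 ?posrE ?exprn_gt0//.
  by rewrite ler_eXn2l// leq_sub2l.
pose c j := G * Tj j.
have c0 j : 0 <= c j by rewrite mulr_ge0// ltW.
(* The budget after [j] batches is [L] times the bound on the expected samples of the preceding
   scale. *)
pose M j := if j is j'.+1 then Num.truncn (L * c j') else 0%N.
have MM : {homo M : m n / (m <= n)%N}.
  case=> [|m] [|n]//= mn; apply: le_truncn; rewrite ler_wpM2l ?(ltW L0)//.
  by rewrite ler_wpM2l// Tjmono.
have Dsq0 : 0 <= Del ^+ 2 / sigma ^+ 2 by rewrite divr_ge0 ?sqr_ge0.
(* The factor rho^(k - j) in the denominator of [Tj j] beats the squared scale rho^(k - j - 1) by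
   one [rho], which [hrho] uses. For [j.+1 = k] the scale is 1, as needed for [mu']. *)
have key j : (j < k)%N -> (M j.+1)%:R * (rho ^+ (k - j.+1) * (Del ^+ 2 / sigma ^+
  2)) <= (2 * L)^-1 ^+ 2.
  move=> jk.
  have h1 : (M j.+1)%:R <= L * c j by rewrite truncn_le mulr_ge0// ltW.
  apply: (@le_trans _ _ (L * c j * (rho ^+ (k - j.+1) * (Del ^+ 2 / sigma ^+ 2)))).
    by rewrite ler_wpM2r// mulr_ge0// exprn_ge0// ltW.
  have -> : L * c j * (rho ^+ (k - j.+1) * (Del ^+ 2 / sigma ^+ 2)) =
      4 * G * L ^+ 3 * (T * Del ^+ 2 / sigma ^+ 2) / rho * (2 * L)^-1 ^+ 2.
    rewrite /c /Tj -(subnSK jk) exprS; field.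
    by rewrite !gt_eqF// exprn_gt0.
  rewrite ler_piMl ?sqr_ge0// ler_pdivrMr// mul1r.
  exact: hrho.
(* [t'] is twice [t] because [mu'] may be at distance [2 * Del] from [mu]. *)
pose t := (2 * L)^-1; pose t' := L^-1.
have t0 : 0 < t by rewrite invr_gt0 mulr_gt0.
have t'0 : 0 < t' by rewrite invr_gt0.
have [mu' [wd' comp' neq hD']] := confusing_instance pb sigma T mu vpb wd T0 invT.
have mu'I : instances pb sigma Tmin Tmax mu'.
  by split=> //; rewrite comp' !lte_fin TminT.
have hsam j : (j < k)%N -> (expected_samples alg P U X (nu j) <= (c j)%:E)%E.
  by move=> _; apply: hG => //; rewrite (nuE j).2 s2.
have hDj j : (j < k)%N -> forall i, `|mu i - nu j i| <= s j * Del.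
  move=> _ i; rewrite /nu dilate1.
  have -> : mu i - (center pb mu + s j * (mu i - center pb mu)) =
    (1 - s j) * (mu i - center pb mu) by ring.
  rewrite normrM; apply: ler_pM => //; last exact: dist_center.
  by rewrite ler0_norm ?subr_le0// opprB lerBlDr lerDl.
have hxj j : (j < k)%N -> (M j)%:R * (s j * Del) ^+ 2 / sigma ^+ 2 <= t ^+ 2.
  case: j => [|j] jk; first by rewrite !mul0r sqr_ge0.
  by have := key j (ltnW jk); rewrite exprMn s2 !mulrA.
have hx' : (M k)%:R * (2 * Del) ^+ 2 / sigma ^+ 2 <= t' ^+ 2.
  have := key k.-1; rewrite prednK// subnn expr0 mul1r => /(_ (leqnn _)).
  rewrite /t' (_ : L^-1 ^+ 2 = 4 * (2 * L)^-1 ^+ 2); last by field; rewrite gt_eqF.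
  rewrite exprMn; lra.
have hp := pr_stopped_le alg sigma0 model mu mu' k M nu c (fun j => s j * Del)
  delta _ t t' (2 * Del) (t ^+ 2) (t' ^+ 2) t0 t'0 erefl MM hsam hDj hxj hD' hx'
  hdelta hmu mu'I neq.
apply: le_trans (expected_batches_ge alg model mu k); rewrite lee_fin.
apply: (rounds_le V L delta (ln rho) (L / ln rho)) => //.
- by rewrite natr1.
- by rewrite divfK// gt_eqF.
apply: (le_trans hp); rewrite (_ : 2 * delta = delta + delta); last by ring.
rewrite -!addrA !lerD2l.
apply: lerD.
  by apply: (transport_cost_le L).
have sumE Y : k%:R * Y = \sum_(j < k) Y :> R by rewrite sumr_const card_ord mulr_natl.
rewrite sumE; apply: ler_sum => j _.
apply: lerD.
  (* Truncation loses less than one sample, so [L * c j < (M j.+1).+1]. *)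
  rewrite ler_pdivrMr// mulrC ler_pdivlMr// mulrC.
  by rewrite ltW// truncnS_gt.
apply: (transport_cost_le L) => //.
by rewrite lef_pV2 ?posrE ?mulr_gt0//; lra.
Qed.

End batch_complexity.

Theorem theorem2p3 (R : realType) (K : nat) (pb : problem R)
  (hpb : valid_problem K pb)
  (sigma : R) (hsigma : 0 < sigma)
  (delta : R) (hdelta : 0 < delta < 1)
  (Tmin Tmax : R) (hTmin : 0 < Tmin) (hTmax : Tmin < Tmax)
  (d : measure_display) (S : measurableType d)
  (alg : batched_algorithm R (answers K pb) S)
  (d' : measure_display) (Omega : measurableType d')
  (P : ('I_K -> R) -> probability Omega R)
  (U : Omega -> S) (X : 'I_K -> nat -> Omega -> R)
  (hmodel : gaussian_bandit sigma (seed_law alg) P U X)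
  (hcorrect : delta_correct alg P U X delta (instances pb sigma Tmin Tmax))
  (mu : 'I_K -> R) (hmu : instances pb sigma Tmin Tmax mu) :
  let L := ln (Tstar pb sigma mu / Tmin) in
  let C := C_delta alg P U X sigma delta Tmin Tmax mu in
  (expected_batches alg P U X mu >=
   mine (L%:E / (2%:E * lne ((L ^+ 2)%:E * maxe (expR 1)%:E C)))
        (mine (L / 6)%:E (1 / (6 * delta))%:E))%E.
Proof.
cbv zeta; set L := ln _; set C := C_delta _ _ _ _ _ _ _ _ _.
have [delta0 delta1] := andP hdelta.
have [compT /andP[TminT TTmax] invT] := instances_Tstar pb sigma Tmin Tmax mu hTmin hmu.
set T := Tstar pb sigma mu in L C compT TminT TTmax invT *.
have T0 : 0 < T by exact: lt_trans TminT.
have L0 : 0 < L by rewrite /L ln_gt0// ltr_pdivlMr// mul1r.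
have R1 := expected_batches_ge1 alg hmodel mu.
pose l := ln (1 / delta).
have l0 : 0 < l by rewrite /l ln_gt0// ltr_pdivlMr// mul1r.
pose y := T * Delta pb mu ^+ 2 / sigma ^+ 2.
have y0 : 0 <= y by rewrite divr_ge0 ?sqr_ge0// mulr_ge0 ?sqr_ge0// ltW.
pose Q := l * L * (1 + Num.sqrt y) ^+ 2.
have Q0 : 0 < Q by rewrite !mulr_gt0// exprn_gt0// ltr_wpDr// sqrtr_ge0.
have gammaP nu T' : instances pb sigma Tmin Tmax nu -> complexity pb sigma nu = T'%:E ->
    (expected_samples alg P U X nu * ((l * T')^-1)%:E <= gamma alg P U X sigma
      delta Tmin Tmax)%E.
  move=> hnu hT'; apply: ereal_sup_ubound; exists nu => //.
  have T'0 : 0 < T' by case: hnu => _; rewrite hT' !lte_fin => /andP[/(lt_trans hTmin)].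
  by rewrite hT' -EFinM inver mulf_eq0 !gt_eqF.
have es0 nu : (0 <= expected_samples alg P U X nu)%E.
  by apply: integral_ge0 => w _; exact: nb_samples_ge0.
have gamma0 : (0 <= gamma alg P U X sigma delta Tmin Tmax)%E.
  apply: le_trans (gammaP mu T hmu compT); rewrite mule_ge0// lee_fin invr_ge0.
  by rewrite mulr_ge0// ltW.
(* If [L <= 6] the second term of the minimum is at most 1, and there is always one batch. *)
have [L6|L6] := leP L 6.
  rewrite ge_min; apply/orP; right; rewrite ge_min; apply/orP; left.
  by apply: le_trans R1; rewrite lee_fin; lra.
have CE : C = (1 + 4%:E * gamma alg P U X sigma delta Tmin Tmax * Q%:E)%E by [].
have LL0 : 0 < L ^+ 2 by rewrite exprn_gt0.
have [[r gE]|gE] : (exists r, gamma alg P U X sigma delta Tmin Tmax = r%:E) \/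
    gamma alg P U X sigma delta Tmin Tmax = +oo%E.
  by move: gamma0; case: (gamma _ _ _ _ _ _ _ _) => [r _| |//]; [left; exists r|right].
- have r0 : 0 <= r by rewrite -lee_fin -gE.
  pose Cr := 1 + 4 * r * Q; have CrE : C = Cr%:E by rewrite CE gE.
  pose rho := L ^+ 2 * Num.max (expR 1) Cr.
  have rhoe : 36 * expR 1 <= rho.
    apply: ler_pM; rewrite ?expR_ge0//; last by rewrite le_max lexx.
    by nra.
  have rho0 : 0 < rho by rewrite (lt_le_trans _ rhoe)// mulr_gt0// expR_gt0.
  have lr4 : 4 <= ln rho.
    rewrite -ler_expR lnK ?posrE//; apply: le_trans rhoe.
    have -> : 4 = 3 + 1 :> R by ring.
    by rewrite expRD ler_wpM2r ?expR_ge0// expR3_le.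
  have lr0 : 0 < ln rho by lra.
  rewrite CrE -EFin_max -EFinM -/rho lne_EFin// -[2%E]/(2%:E) -EFinM inver gt_eqF
    ?mulr_gt0//.
  rewrite -EFinM -!EFin_min.
  set V := Num.min _ _.
  have [V1|V1] := leP V 1; first by apply: le_trans R1; rewrite lee_fin.
  have hV : [/\ V <= L / ln rho / 2, V <= L / 6 & V * (6 * delta) <= 1].
    split.
    - rewrite -mulrA -invfM mulrC [ln rho * 2]mulrC [_^-1 * L]mulrC.
      by rewrite ge_min lexx.
    - by rewrite ge_min ge_min lexx !orbT.
    - rewrite -ler_pdivlMr ?mulr_gt0//.
      by rewrite ge_min ge_min lexx !orbT.
  case: hV => hV1 hV2 hV3.
  apply: (expected_batches_lower_bound alg hsigma hmodel delta Tmin Tmax (r * l)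
    rho V mu) => //.
  - by rewrite mulr_ge0// ltW.
  - move=> nu T' hnu hT'; have := gammaP nu T' hnu hT'; rewrite gE.
    have T'0 : 0 < T' by case: hnu => _;
      rewrite hT' !lte_fin => /andP[/(lt_trans hTmin)].
    have lT0 : 0 < l * T' by rewrite mulr_gt0.
    have := es0 nu; case: (expected_samples _ _ _ _ _) => [e _| _|//].
      by rewrite -EFinM !lee_fin ler_pdivrMr// mulrA.
    by rewrite gt0_mulye ?lte_fin ?invr_gt0.
  - exact: ltW.
  - apply: (@le_trans _ _ (L ^+ 2 * Cr));
    last by rewrite ler_wpM2l ?(ltW LL0)// le_max lexx orbT.
    (* Of the required 4 r l L^3 y, the factor L^2 is the prefactor of [rho], and 4 r l L y is at
       most [Cr - 1]. *)
    have yQ : y <= (1 + Num.sqrt y) ^+ 2.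
      have := sqr_sqrtr y0; have := sqrtr_ge0 y; move: (Num.sqrt y) => z z0 <-.
      by nra.
    rewrite -/T -/L -/y /Cr mulrDr mulr1; apply: (@le_trans _ _ (L ^+ 2 * (4 * r * Q))).
      rewrite (_ : 4 * (r * l) * L ^+ 3 * y = L ^+ 2 * (4 * r * (l * L * y)));
        last by ring.
      rewrite ler_wpM2l ?(ltW LL0)// ler_wpM2l ?mulr_ge0// ler_wpM2l// ltW// mulr_gt0//.
    by rewrite lerDr ltW.
(* With [gamma] infinite the logarithm is [+oo], its inverse is 0, and the minimum is at most 0. *)
- have -> : C = +oo%E.
    by rewrite CE gE gt0_muley ?lte_fin// gt0_mulye ?lte_fin// addey.
  rewrite maxey gt0_muley ?lte_fin//= gt0_muley// invey mule0.
  by apply: le_trans R1; rewrite ge_min lee01.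
Qed.
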